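(* Let $X,Y,Z$ be standard Borel spaces and $\pi$ a kernel from $Z$ to $X\times Y$. Let $\mu$ be the kernel from $Z$ to $X$ given by $\mu^z=(\mathrm{pr}_X)_\ast\pi^z$ and $\nu$ the kernel from $Z$ to $Y$ given by $\nu^z=(\mathrm{pr}_Y)_\ast\pi^z$. Then there exists a Borel map $T:Z\times X\times[0,1]\to Y\times[0,1]$ such that for every $z\in Z$ the map $T^z:X\times[0,1]\to Y\times[0,1]$, $(x,u)\mapsto T(z,x,u)$, is a Borel isomorphism satisfying (i) $T^z_\ast(\mu^z\otimes\lambda)=\nu^z\otimes\lambda$ and (ii) $(\mathrm{pr}_{XY})_\ast(\mathrm{id},T^z)_\ast(\mu^z\otimes\lambda)=\pi^z$.
   Context: A kernel from $Z$ to $W$ is a Borel map $z\mapsto\pi^z\in\mathcal P(W)$. $\lambda$ is Lebesgue measure on $[0,1]$. $\mathrm{pr}_{XY}:X\times[0,1]\times Y\times[0,1]\to X\times Y$ is the projection. A Borel isomorphism is a Borel bijection with Borel inverse. Standing assumption: all standard Borel spaces are uncountable. *)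

(* Defs.v *)
From HB Require Import structures.
From mathcomp Require Import all_boot all_order all_algebra.
From mathcomp Require Import all_classical all_reals all_analysis.
Import Order.TTheory GRing.Theory Num.Theory.
Local Open Scope classical_set_scope.
Local Open Scope ring_scope.

Definition polish (R : realType) (P : topologicalType) : Prop :=
  (exists D : set P, countable D /\ closure D = setT) /\
  exists dist : P -> P -> R,
    [/\ (forall x y, dist x y = 0 <-> x = y),
        (forall x y, dist x y = dist y x),
        (forall x y z, dist x z <= dist x y + dist y z),
        (forall A : set P, open A <->
           (forall x, A x -> exists2 e : R, 0 < e & [set y | dist x y < e] `<=` A)) &
        (forall u : nat -> P,
           (forall e : R, 0 < e -> exists N : nat, forall m n : nat,
               (N <= m)%N -> (N <= n)%N -> dist (u m) (u n) < e) ->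
           exists l : P, forall e : R, 0 < e -> exists N : nat, forall n : nat,
               (N <= n)%N -> dist l (u n) < e)].

Definition standard_Borel (R : realType) {d} (T : measurableType d) : Prop :=
  exists (P : topologicalType) (f : T -> P),
    [/\ polish R P, bijective f &
        forall A : set T, measurable A <-> <<s (@open P) >> (f @` A)].

Section unit_interval.
Variable R : realType.

Definition I01 := {x : R | (0 <= x <= 1)}.
HB.instance Definition _ := Choice.on I01.

Lemma I01_0 : ((0:R) <= 0) && ((0:R) <= 1).
Proof. by apply/andP; split; [exact: lexx | exact: ler01]. Qed.

HB.instance Definition _ := isPointed.Build I01 (exist _ 0 I01_0).

Definition I01_measurable : set (set I01) :=
  preimage_set_system setT (@sval R _) (@measurable _ R).

HB.instance Definition _ := @isMeasurable.Build (sigma_display I01_measurable)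
  I01 <<s I01_measurable >> (@sigma_algebra0 _ setT I01_measurable)
  (@sigma_algebraC _ I01_measurable)
  (@sigma_algebra_bigcup _ setT I01_measurable).

Definition lambda01 : set I01 -> \bar R :=
  fun A => (@lebesgue_measure R) (@sval R _ @` A).

End unit_interval.

(* Main.v *)
(** Disintegrate pi^z(dx, dy) = mu^z(dx) k^(z,x)(dy) = nu^z(dy) k'^(z,y)(dx),
    measurably in z. Every kernel k on Y admits isomorphisms of [0, 1] onto
    Y x [0, 1], jointly measurable with their inverses, pushing lambda to
    k^w (x) lambda: this product is atomless, so the quantile function of its
    image in the line is a measure preserving injection with measurable
    inverse up to null sets, and the null sets are repaired by a
    Schroeder-Bernstein argument using copies of the Cantor set. Applied to k
    and k' this identifies both X x [0, 1] and Y x [0, 1] with X x Y x [0, 1]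
    carrying pi^z (x) lambda, keeping the coordinate x, resp. y; T^z is the
    composite of these two identifications.

    The disintegration itself uses the same isomorphism for mu^z to reduce to
    a uniform first marginal, where conditional distribution functions are
    limits of ratios over shrinking balls by Lebesgue differentiation. *)
Require Import Defs.
From HB Require Import structures.
From mathcomp Require Import all_boot all_order all_algebra.
From mathcomp Require Import all_classical all_reals all_analysis.
From mathcomp Require Import measurable_realfun ring lra.
Import Order.TTheory GRing.Theory Num.Theory.
Import numFieldNormedType.Exports.
Local Open Scope classical_set_scope.
Local Open Scope ring_scope.

(** The obstacle throughout is measurability in the parameter. A choice made separately for each z,
    or up to a null set that moves with z, does not give a Borel map, so every map is an explicit
    formula valid at all points, and almost everywhere identities are used only inside measures and
    integrals. This is why densities are upper limits of ratios: they exist everywhere, are jointly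
    measurable and inherit monotonicity in the set; a Radon-Nikodym derivative appears only for
    fixed z, to compute an integral.

    Borel images under injections are avoided as well: an embedding always comes with a Borel left
    inverse, so its range is the set where an equation holds.

    The Cantor set C is useful because it is null and yet every standard Borel space embeds in it.
    One copy, Y x C, lies in the target and receives the points of [0, 1] where the quantile map
    fails; another lies in [0, 1] and receives the points of the target that are missed. Neither
    affects a law. *)

Lemma measure_subset d (T : measurableType d) (R : realType)
    (mu : {measure set T -> \bar R}) (A B : set T) :
  measurable A -> measurable B -> A `<=` B -> (mu A <= mu B)%E.
Proof. by move=> mA mB AB; apply: le_measure; rewrite ?inE. Qed.

(** * Coding standard Borel spaces by reals *)

Section cantor_coding.
Context {R : realType}.
Implicit Types (s : nat -> bool) (t : R).

(** Horner form of the partial sums of the terms [2 * s k / 3 ^ (k + 1)]: splitting off the leading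
    digit turns the self-similarity of the Cantor set into the recursion. *)
Fixpoint ternary_sum n s : R :=
  if n is m.+1 then (2 * (s 0)%:R + ternary_sum m (fun k => s k.+1)) / 3 else 0.

Lemma ternary_sum_ge0 n s : 0 <= ternary_sum n s.
Proof.
elim: n s => [//|n IH] s /=.
by rewrite divr_ge0// addr_ge0// mulr_ge0.
Qed.

Lemma ternary_sum_le1 n s : ternary_sum n s <= 1.
Proof.
elim: n s => [//|n IH] s /=.
by have := IH (fun k => s k.+1); case: (s 0%N) => /= ?; lra.
Qed.

Lemma ternary_sum_nd s : nondecreasing_seq (ternary_sum ^~ s).
Proof.
apply/nondecreasing_seqP => n; elim: n s => [|n IH] s.
  exact: ternary_sum_ge0.
by rewrite [in leLHS]/= [in leRHS]/= ler_pM2r// lerD2l; exact: IH.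
Qed.

Lemma ternary_sum_cvg s : cvgn (ternary_sum ^~ s).
Proof.
apply: nondecreasing_is_cvgn; first exact: ternary_sum_nd.
by exists 1 => _ [n _ <-]; exact: ternary_sum_le1.
Qed.

Definition cantor_real s : R := limn (ternary_sum ^~ s).

Lemma cantor_real_ge0 s : 0 <= cantor_real s.
Proof.
apply: limr_ge; first exact: ternary_sum_cvg.
by apply: nearW => n; exact: ternary_sum_ge0.
Qed.

Lemma cantor_real_le1 s : cantor_real s <= 1.
Proof.
apply: limr_le; first exact: ternary_sum_cvg.
by apply: nearW => n; exact: ternary_sum_le1.
Qed.

Lemma cantor_real_rec s :
  cantor_real s = (2 * (s 0)%:R + cantor_real (fun k => s k.+1)) / 3.
Proof.
apply/cvg_lim => //; rewrite -cvg_shiftS /=.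
apply: cvgM; last exact: cvg_cst.
by apply: cvgD; [exact: cvg_cst|exact: ternary_sum_cvg].
Qed.

(** Tripling with the leading digit removed. The threshold 1/2 lies in the middle gap, so it
    separates the digits 0 and 2 on the Cantor set while the digits remain total Borel functions on
    the line. *)
Definition ternary_shift t : R := if 2^-1 <= t then 3 * t - 2 else 3 * t.

Definition ternary_digit n t : bool := 2^-1 <= iter n ternary_shift t.

Lemma ternary_digit0 s : (2^-1 <= cantor_real s) = s 0.
Proof.
rewrite cantor_real_rec.
have := cantor_real_ge0 (fun k => s k.+1).
have := cantor_real_le1 (fun k => s k.+1).
by case: (s 0%N) => /= ? ?; [apply/idP; lra|apply/negP; lra].
Qed.

Lemma ternary_shift_cantor s :
  ternary_shift (cantor_real s) = cantor_real (fun k => s k.+1).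
Proof.
rewrite /ternary_shift ternary_digit0 [in LHS]cantor_real_rec.
by case: (s 0%N) => /=; lra.
Qed.

Lemma ternary_digitK s n : ternary_digit n (cantor_real s) = s n.
Proof.
rewrite /ternary_digit; elim: n s => [|n IH] s; first exact: ternary_digit0.
by rewrite iterSr ternary_shift_cantor IH.
Qed.

Lemma measurable_ternary_shift : measurable_fun [set: R] ternary_shift.
Proof.
apply: measurable_fun_ifT; first exact: measurable_fun_ler.
  by apply: measurable_funB => //; exact: measurable_funM.
exact: measurable_funM.
Qed.

Lemma measurable_ternary_digit n : measurable_fun [set: R] (ternary_digit n).
Proof.
apply: measurable_fun_ler => //.
elim: n => [|n IH]; first exact: measurable_id.
exact: (measurableT_comp measurable_ternary_shift IH).
Qed.

Lemma measurable_cantor_real d (T : measurableType d) (b : nat -> T -> bool) :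
  (forall n, measurable_fun [set: T] (b n)) ->
  measurable_fun [set: T] (fun x => cantor_real (b ^~ x)).
Proof.
move=> mb; apply: (@measurable_fun_cvg _ _ _ _
    (fun n x => ternary_sum n (b ^~ x))); last first.
  by move=> x _; exact: ternary_sum_cvg.
move=> n; elim: n b mb => [|n IH] b mb /=; first exact: measurable_cst.
apply: measurable_funM => //; apply: measurable_funD.
  apply: measurable_funM => //.
  rewrite [X in measurable_fun _ X](_ : _ =
    (fun x => if b 0%N x then 1 else 0)); last first.
    by apply/funext => x; case: (b 0%N x).
  exact: measurable_fun_ifT.
by apply: IH => k; exact: mb.
Qed.

(** Fixed points of decoding followed by encoding. This is the range of [cantor_real], in a form
    that is Borel at once as an equality of two measurable functions. *)
Definition cantor_set : set R := [set t | cantor_real (ternary_digit ^~ t) = t].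

Lemma cantor_set_real s : cantor_set (cantor_real s).
Proof.
rewrite /cantor_set /=; congr cantor_real.
by apply/funext => n; rewrite ternary_digitK.
Qed.

Lemma measurable_cantor_set : measurable cantor_set.
Proof.
have := @measurable_fun_eqr _ R R setT _ _
  (measurable_cantor_real _ _ ternary_digit measurable_ternary_digit)
  (@measurable_id _ _ setT).
move=> /(_ measurableT [set true]) /=; rewrite setTI => /(_ I).
by congr measurable; apply/seteqP; split => t /= /eqP.
Qed.

Lemma cantor_set_itv : cantor_set `<=` `[0, 1].
Proof.
by move=> t <-; rewrite /= in_itv/= cantor_real_ge0 cantor_real_le1.
Qed.

(* The Cantor set is covered by two copies of itself scaled by 1/3; the scaled
   copies of level n are controlled simultaneously, by induction on the number
   of subdivisions. *)
Lemma cantor_set_null : lebesgue_measure cantor_set = 0%E.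
Proof.
pose C n (a : R) : set R := [set t | cantor_set (3 ^+ n * (t - a))].
have mC n a : measurable (C n a).
  rewrite -[X in measurable X]setTI.
  apply: (_ : measurable_fun setT (fun t => 3 ^+ n * (t - a))) => //.
    by apply: measurable_funM => //; exact: measurable_funB.
  exact: measurable_cantor_set.
have step n a : C n a `<=` C n.+1 a `|` C n.+1 (a + 2 / 3 ^+ n.+1).
  move=> t; rewrite /C /=; set x := 3 ^+ n * (t - a) => Cx.
  have n3 : 3 ^+ n.+1 != 0 :> R by rewrite expf_neq0.
  have -> : 3 ^+ n.+1 * (t - a) = 3 * x by rewrite /x exprS; ring.
  have -> : 3 ^+ n.+1 * (t - (a + 2 / 3 ^+ n.+1)) = 3 * x - 2.
    transitivity (3 ^+ n.+1 * (t - a) - 2 * (3 ^+ n.+1 / 3 ^+ n.+1)).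
      by ring.
    by rewrite divff// exprS /x; ring.
  have := ternary_shift_cantor (ternary_digit ^~ x); rewrite Cx /ternary_shift.
  by case: ifPn => _ ->; [right|left]; exact: cantor_set_real.
have bound m : forall n a,
    (lebesgue_measure (C n a) <= (2 ^+ m / 3 ^+ (n + m))%:E)%E.
  elim: m => [|m IH] n a.
    have n3 : 0 < 3 ^+ n :> R by rewrite exprn_gt0.
    have sub : C n a `<=` `[a, a + (3 ^+ n)^-1].
      move=> t /cantor_set_itv /=; rewrite !in_itv/= => /andP[h0 h1].
      apply/andP; split.
        by move: h0; rewrite pmulr_rge0// subr_ge0.
      by rewrite -lerBlDl -[leRHS]mul1r ler_pdivlMr// mulrC.
    apply: (@le_trans _ _ (lebesgue_measure `[a, a + (3 ^+ n)^-1])).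
      by apply: measure_subset => //; exact: mC.
    rewrite lebesgue_measure_itv/= lte_fin ltrDl invr_gt0 n3.
    by rewrite -EFinD addrAC subrr add0r expr0 mul1r addn0.
  apply: (le_trans (measure_subset _ _ _ lebesgue_measure _ _ _ _ (step n a))).
  - exact: mC.
  - by apply: measurableU; exact: mC.
  set b := a + _.
  apply: (@le_trans _ _ (lebesgue_measure (C n.+1 a) +
                         lebesgue_measure (C n.+1 b))%E).
    by apply: measureU2; exact: mC.
  apply: (le_trans (leeD (IH _ _) (IH _ _))).
  rewrite -EFinD lee_fin addSnnS (exprS 2 m).
  by rewrite le_eqVlt; apply/orP; left; apply/eqP; ring.
have sub0 : cantor_set `<=` C 0 0.
  by move=> t; rewrite /C/= expr0 mul1r subr0.
apply/eqP; rewrite eq_le measure_ge0 andbT.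
have cv : ((fun m => ((2 / 3 : R) ^+ m)%:E) @ \oo --> 0%E)%E.
  apply: cvg_EFin; first by apply: nearW.
  by apply: cvg_expr; rewrite ger0_norm; lra.
rewrite -(cvg_lim _ cv)//; apply: lime_ge; first by apply/cvg_ex; exists 0%E.
apply: nearW => m; apply: le_trans (le_trans (bound m 0%N 0) _).
  by apply: measure_subset => //; [exact: measurable_cantor_set|exact: mC].
by rewrite add0n expr_div_n.
Qed.

End cantor_coding.

Lemma measurable_forall d (T : measurableType d) (I : countType)
    (P : I -> set T) :
  (forall i, measurable (P i)) -> measurable [set t | forall i, P i t].
Proof.
move=> mP.
rewrite [X in measurable X](_ : _ =
    \bigcap_n (if unpickle n is Some i then P i else setT)).
  by apply: bigcapT_measurable => n; case: unpickle.
apply/seteqP; split => [t /= Pt n _|t /= Pt i].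
  by case: unpickle => // i; exact: Pt.
by have := Pt (pickle i) Logic.I; rewrite pickleK.
Qed.

Lemma measurable_exists d (T : measurableType d) (I : countType)
    (P : I -> set T) :
  (forall i, measurable (P i)) -> measurable [set t | exists i, P i t].
Proof.
move=> mP; rewrite -[X in measurable X]setCK; apply: measurableC.
rewrite [X in measurable X](_ : _ = [set t | forall i, (~` P i) t]).
  by apply: measurable_forall => i; exact: measurableC.
apply/seteqP; split => [t /= nP i Pi|t /= nP [i]]; last exact: nP.
by apply: nP; exists i.
Qed.

Lemma measurable_imply d (T : measurableType d) (A B : set T) :
  measurable A -> measurable B -> measurable [set t | A t -> B t].
Proof.
move=> mA mB; rewrite [X in measurable X](_ : _ = ~` A `|` B).
  by apply: measurableU => //; exact: measurableC.
apply/seteqP; split => [t /= AB|t /= [nA|//] /nA//].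
by have [/AB|] := pselect (A t); [right|left].
Qed.

Lemma measurable_const_imply d (T : measurableType d) (C : Prop) (B : set T) :
  measurable B -> measurable [set t | C -> B t].
Proof.
move=> mB; have [c|nc] := pselect C.
  by rewrite [X in measurable X](_ : _ = B)//; apply/seteqP; split => t/=; auto.
rewrite [X in measurable X](_ : _ = setT)//.
by apply/seteqP; split => // t _ /nc.
Qed.

Lemma measurable_set_comp d (T : measurableType d) d' (T' : measurableType d')
    (f : T -> T') (B : set T') :
  measurable_fun [set: T] f -> measurable B -> measurable [set x | B (f x)].
Proof. by move=> mf mB; rewrite -[X in measurable X]setTI; exact: mf. Qed.

Lemma measurable_fun_true d (T : measurableType d) (b : T -> bool) :
  measurable_fun [set: T] b -> measurable [set t | b t].
Proof.
by move=> /(_ measurableT [set true] I); rewrite setTI preimage_true.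
Qed.

Lemma measurable_fun_pred d (T : measurableType d) (b : T -> bool) :
  measurable [set t | b t] -> measurable_fun [set: T] b.
Proof.
move=> mb; apply: (measurable_fun_bool true).
by rewrite setTI preimage_true.
Qed.

Section real_cuts.
Context {R : realType}.

Definition rat_seq (n : nat) : rat := odflt 0 (unpickle n).

Lemma rat_seqP (q : rat) : exists n, rat_seq n = q.
Proof. by exists (pickle q); rewrite /rat_seq pickleK. Qed.

Definition real_cut (x : R) (n : nat) : bool := x < ratr (rat_seq n).

(** The infimum is taken in the extended reals so that every bit sequence has a value: rejected
    rationals contribute [+oo], and [fine] sends infinite infima to 0. *)
Definition real_of_cut (s : nat -> bool) : R :=
  fine (einfs (fun n => if s n then (ratr (rat_seq n) : R)%:E else +oo)%E 0).

Lemma real_cutK x : real_of_cut (real_cut x) = x.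
Proof.
rewrite /real_of_cut; set u := (fun n => _).
suff -> : einfs u 0 = x%:E by [].
apply/eqP; rewrite eq_le; apply/andP; split.
  apply/lee_addgt0Pr => e e0.
  have [q] := @rat_in_itvoo R x (x + e) (ltr_pwDr e0 (lexx _)).
  rewrite in_itv/= => /andP[xq qe]; have [n nq] := rat_seqP q.
  apply: (@le_trans _ _ (u n)).
    by apply: ereal_inf_lbound; exists n.
  by rewrite /u /real_cut nq xq -EFinD lee_fin ltW.
apply: le_ereal_inf_tmp => _ [n _ <-]; rewrite /u /real_cut.
by case: ifPn => [xq|_]; rewrite ?leey// lee_fin ltW.
Qed.

Lemma measurable_real_of_cut d (T : measurableType d) (c : nat -> T -> bool) :
  (forall n, measurable_fun [set: T] (c n)) ->
  measurable_fun [set: T] (fun x => real_of_cut (c ^~ x)).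
Proof.
move=> mc; apply: (measurableT_comp (fine_measurable measurableT)) => /=.
apply: (@measurable_fun_einfs _ _ _ _ (fun n x =>
   if c n x then (ratr (rat_seq n) : R)%:E else +oo%E)) => n.
exact: measurable_fun_ifT.
Qed.

Lemma measurable_real_cut n : measurable_fun [set: R] (real_cut ^~ n).
Proof. exact: measurable_fun_ltr. Qed.

End real_cuts.

Section retract.
Context (R : realType).

(* Spaces Borel isomorphic to a Borel subset of the line. *)
Definition real_retract {d} (T : measurableType d) :=
  exists (e : T -> R) (r : R -> T),
    [/\ measurable_fun [set: T] e, measurable_fun [set: R] r & cancel e r].

(** The cut of [e x] among the rationals is a bit sequence, hence a point of the Cantor set. In this
    normal form codes lie in [0, 1] and, moreover, in a null set. *)
Lemma real_retract_cantor d (T : measurableType d) : real_retract T ->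
  exists (e : T -> R) (r : R -> T),
    [/\ measurable_fun [set: T] e, measurable_fun [set: R] r, cancel e r &
        forall x, cantor_set (e x)].
Proof.
move=> [e [r [me mr er]]].
exists (fun x => cantor_real (real_cut (e x))).
exists (fun t => r (real_of_cut (ternary_digit ^~ t))); split.
- apply: (measurable_cantor_real _ _ (fun n x => real_cut (e x) n)) => n.
  exact: (measurableT_comp (measurable_real_cut n) me).
- apply: (measurableT_comp mr).
  by apply: measurable_real_of_cut; exact: measurable_ternary_digit.
- move=> x; rewrite [X in real_of_cut X](_ : _ = real_cut (e x)).
    by rewrite real_cutK er.
  by apply/funext => n; rewrite ternary_digitK.
- by move=> x; exact: cantor_set_real.
Qed.

(** Interleaving: even digits carry the cut of the first coordinate, odd digits that of the
    second. *)
Lemma real_retract_prod d1 d2 (T1 : measurableType d1)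
    (T2 : measurableType d2) :
  real_retract T1 -> real_retract T2 -> real_retract (T1 * T2)%type.
Proof.
move=> [e1 [r1 [me1 mr1 er1]]] [e2 [r2 [me2 mr2 er2]]].
pose b n (p : T1 * T2) :=
  if odd n then real_cut (e2 p.2) n./2 else real_cut (e1 p.1) n./2.
exists (fun p => cantor_real (b ^~ p)).
exists (fun t => (r1 (real_of_cut (fun n => ternary_digit n.*2 t)),
                  r2 (real_of_cut (fun n => ternary_digit n.*2.+1 t)))); split.
- apply: measurable_cantor_real => n; rewrite /b; case: (odd n).
    exact: (measurableT_comp (measurable_real_cut _)
             (measurableT_comp me2 measurable_snd)).
  exact: (measurableT_comp (measurable_real_cut _)
             (measurableT_comp me1 measurable_fst)).
- apply: measurable_fun_pair.
    apply: (measurableT_comp mr1); apply: measurable_real_of_cut => n.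
    exact: measurable_ternary_digit.
  apply: (measurableT_comp mr2); apply: measurable_real_of_cut => n.
  exact: measurable_ternary_digit.
- move=> [x y].
  rewrite [X in r1 (real_of_cut X)](_ : _ = real_cut (e1 x)); last first.
    by apply/funext => n; rewrite ternary_digitK /b odd_double doubleK.
  rewrite [X in r2 (real_of_cut X)](_ : _ = real_cut (e2 y)); last first.
    apply/funext => n.
    by rewrite ternary_digitK /b /= odd_double /= uphalf_double.
  by rewrite !real_cutK er1 er2.
Qed.

(** The left inverse makes [e] injective, so equality can be tested between real codes, where it is
    Borel. *)
Lemma real_retract_diag d (T : measurableType d) d' (W : measurableType d')
    (f g : W -> T) : real_retract T ->
  measurable_fun [set: W] f -> measurable_fun [set: W] g ->
  measurable [set w | f w = g w].
Proof.
move=> [e [r [me _ er]]] mf mg.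
rewrite [X in measurable X](_ : _ = [set w | e (f w) == e (g w)]).
  apply: measurable_fun_true.
  by apply: measurable_fun_eqr; exact: (measurableT_comp me).
by apply/seteqP; split => w /=; [move=> ->|move=> /eqP/(can_inj er)].
Qed.

End retract.

(** * Points of a Polish space coded by rational balls around a dense sequence *)

Section polish_coding.
Context {R : realType} {P : topologicalType} (dist : P -> P -> R).
Hypotheses (dist0 : forall x y, dist x y = 0 <-> x = y)
  (dist_sym : forall x y, dist x y = dist y x)
  (dist_tri : forall x y z, dist x z <= dist x y + dist y z)
  (dist_open : forall A : set P, open A <->
     (forall x, A x -> exists2 e : R, 0 < e & [set y | dist x y < e] `<=` A))
  (dist_complete : forall u : nat -> P,
     (forall e : R, 0 < e -> exists N : nat, forall m n : nat,
         (N <= m)%N -> (N <= n)%N -> dist (u m) (u n) < e) ->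
     exists l : P, forall e : R, 0 < e -> exists N : nat, forall n : nat,
         (N <= n)%N -> dist l (u n) < e).
Variable xs : nat -> P.
Hypothesis xs_dense : forall x e, 0 < e -> exists n, dist x (xs n) < e.

Definition ball_bit (x : P) (n : nat) (q : rat) : bool :=
  dist x (xs n) < ratr q.

Definition ball_digit (t : R) (n : nat) (q : rat) : bool :=
  ternary_digit (pickle (n, q)) t.

Lemma open_dist_ball (c : P) (e : R) : open [set x | dist x c < e].
Proof.
apply/dist_open => x /= xe; exists (e - dist x c); first by rewrite subr_gt0.
move=> y /= yx; rewrite (le_lt_trans (dist_tri y x c))// dist_sym.
by rewrite -ltrBrDr.
Qed.

Lemma ball_bit_inj x y : ball_bit x = ball_bit y -> x = y.
Proof.
move=> xy; apply/dist0; have dxx : dist x x = 0 by exact/dist0.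
have dge0 : 0 <= dist x y.
  by have := dist_tri x y x; rewrite dxx (dist_sym y x); lra.
apply/eqP; rewrite eq_le dge0 andbT leNgt; apply/negP => d0.
have [q] := @rat_in_itvoo R 0 (dist x y / 2) ltac:(lra).
rewrite in_itv/= => /andP[q0 qd].
have [n xn] := xs_dense x _ q0.
have : ball_bit y n q by rewrite -xy.
rewrite /ball_bit => yn.
by have := dist_tri x (xs n) y; rewrite (dist_sym (xs n)); lra.
Qed.

(* The cuts q |-> (d(x, x_n) < q) that come from a point x are those given by
   a family of "distances to x_n" compatible with the triangle inequality and
   with infimum 0; completeness provides the point. *)
Definition ball_code (s : nat -> rat -> bool) : Prop :=
  [/\ (forall i : nat * rat, s i.1 i.2 ->
         exists q' : rat, q' < i.2 /\ s i.1 q'),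
      (forall i j : nat * rat, s i.1 i.2 -> s j.1 j.2 ->
         dist (xs i.1) (xs j.1) < ratr (i.2 + j.2)),
      (forall i j : nat * rat, dist (xs i.1) (xs j.1) <= ratr (i.2 - j.2) ->
         s j.1 j.2 -> s i.1 i.2) &
      (forall k : nat, exists n, s n (k.+1%:R^-1))].

Lemma ball_bit_code x : ball_code (ball_bit x).
Proof.
split.
- move=> [n q] /=; rewrite /ball_bit => /rat_in_itvoo[q'].
  rewrite in_itv/= => /andP[xq' q'q]; exists q'; split => //.
  by move: q'q; rewrite ltr_rat.
- move=> [n q] [m r] /=; rewrite /ball_bit rmorphD/= => xn xm.
  by have := dist_tri (xs n) x (xs m); rewrite (dist_sym (xs n) x); lra.
- move=> [n q] [m r] /=; rewrite /ball_bit rmorphB/= => nm xm.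
  by have := dist_tri x (xs m) (xs n); rewrite (dist_sym (xs m) (xs n)); lra.
- move=> k; have [n xn] := xs_dense x (k.+1%:R^-1) ltac:(by rewrite invr_gt0).
  by exists n; rewrite /ball_bit fmorphV/= ratr_nat.
Qed.

(** The fourth clause selects centres at radius [1 / (k + 1)], the second makes them a Cauchy
    sequence, and its limit is the point. A ball around the limit belongs to the code by the third
    clause; conversely the first clause shrinks the radius strictly, which leaves room to pass to
    the limit in the second. *)
Lemma ball_code_bit s : ball_code s -> exists x, ball_bit x = s.
Proof.
move=> [s1 s2 s3 s4].
have [u su] : exists u : nat -> nat, forall k, s (u k) (k.+1%:R^-1).
  by exists (fun k => projT1 (cid (s4 k))) => k; case: cid.
have ratrV k : ratr (k.+1%:R^-1) = k.+1%:R^-1 :> R.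
  by rewrite fmorphV/= ratr_nat.
have small (e : R) : 0 < e ->
    exists N, forall k, (N <= k)%N -> (k.+1%:R^-1 : R) < e.
  move=> e0; have [N] := @ltr_add_invr R 0 e e0; rewrite add0r => Ne.
  exists N => k Nk; rewrite (le_lt_trans _ Ne)// lef_pV2 ?posrE//.
  by rewrite ler_nat.
have [|l lu] := dist_complete (fun k => xs (u k)).
  move=> e e0; have [N Ne] := small (e / 2) ltac:(lra).
  exists N => m n Nm Nn.
  have := s2 (_, _) (_, _) (su m) (su n).
  rewrite /= rmorphD/= !ratrV.
  have := Ne _ Nm; have := Ne _ Nn.
  by move: (m.+1%:R^-1) (n.+1%:R^-1) => ? ?; lra.
exists l; apply/funext => n; apply/funext => q; apply/idP/idP.
  rewrite /ball_bit => ln.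
  have e0 : 0 < (ratr q - dist l (xs n)) / 2 by lra.
  have [N1 h1] := lu _ e0; have [N2 h2] := small _ e0.
  pose k := maxn N1 N2.
  have {}h1 := h1 k (leq_maxl _ _); have {}h2 := h2 k (leq_maxr _ _).
  apply: (s3 (n, q) (u k, k.+1%:R^-1)) (su k).
  rewrite /= rmorphB/= ratrV.
  have := dist_tri (xs n) l (xs (u k)); rewrite (dist_sym (xs n) l).
  by move: h2; move: (k.+1%:R^-1) => ?; lra.
move=> snq; have [q' /= [q'q snq']] := s1 (n, q) snq.
have e0 : 0 < (ratr q - ratr q' : R) / 2.
  by rewrite divr_gt0// subr_gt0 ltr_rat.
have [N1 h1] := lu _ e0; have [N2 h2] := small _ e0.
pose k := maxn N1 N2.
have {}h1 := h1 k (leq_maxl _ _); have {}h2 := h2 k (leq_maxr _ _).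
have := s2 (_, _) (_, _) (su k) snq'; rewrite /= rmorphD/= ratrV.
rewrite /ball_bit; have := dist_tri l (xs (u k)) (xs n).
by move: h2; move: (k.+1%:R^-1) => ?; lra.
Qed.

(** A preimage under decoding, not an image under encoding: it commutes with countable unions and
    relative complements, so its measurability needs no theorem on injective images of Borel
    sets. *)
Definition code_set (A : set P) : set R :=
  [set t | exists2 x, A x & ball_bit x = ball_digit t].

Lemma measurable_ball_digit n q : measurable [set t | ball_digit t n q].
Proof. by apply: measurable_fun_true; exact: measurable_ternary_digit. Qed.

Lemma measurable_code_setT : measurable (code_set setT).
Proof.
have mdig := measurable_ball_digit.
rewrite [X in measurable X](_ : _ = [set t | ball_code (ball_digit t)]).
  rewrite [X in measurable X](_ : _ =
      [set t | forall i : nat * rat, ball_digit t i.1 i.2 ->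
         exists q' : rat, q' < i.2 /\ ball_digit t i.1 q'] `&`
      [set t | forall i j : nat * rat, ball_digit t i.1 i.2 ->
         ball_digit t j.1 j.2 -> dist (xs i.1) (xs j.1) < ratr (i.2 + j.2)] `&`
      [set t | forall i j : nat * rat,
         dist (xs i.1) (xs j.1) <= ratr (i.2 - j.2) ->
         ball_digit t j.1 j.2 -> ball_digit t i.1 i.2] `&`
      [set t | forall k : nat, exists n, ball_digit t n (k.+1%:R^-1)]).
    apply: measurableI; [apply: measurableI; [apply: measurableI|]|].
    - apply: measurable_forall => i; apply: measurable_imply; first exact: mdig.
      have mex := @measurable_exists _ R rat
        (fun q' => [set t | q' < i.2 /\ ball_digit t i.1 q']).
      apply: mex => q'; have [qi|qi] := boolP (q' < i.2).
        rewrite [X in measurable X](_ : _ = [set t | ball_digit t i.1 q'])//.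
        by apply/seteqP; split => t /= => [[]|].
      rewrite [X in measurable X](_ : _ = set0)//.
      by apply/seteqP; split => t // -[].
    - apply: measurable_forall => i; apply: measurable_forall => j.
      apply: measurable_imply; first exact: mdig.
      apply: (measurable_imply _ _ [set t | ball_digit t j.1 j.2]
         [set t | dist (xs i.1) (xs j.1) < ratr (i.2 + j.2)]); first exact: mdig.
      have [h|h] := boolP (dist (xs i.1) (xs j.1) < ratr (i.2 + j.2)).
        by rewrite [X in measurable X](_ : _ = setT)//; apply/seteqP; split.
      by rewrite [X in measurable X](_ : _ = set0)//; apply/seteqP; split.
    - apply: measurable_forall => i; apply: measurable_forall => j.
      by apply: measurable_const_imply; apply: measurable_imply; exact: mdig.
    - apply: measurable_forall => k.
      have mex := @measurable_exists _ R nat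
        (fun n => [set t | ball_digit t n (k.+1%:R^-1)]).
      by apply: mex => n; exact: mdig.
  by apply/seteqP; split => t /= => [[? ? ? ?]|[[[? ?] ?] ?]].
apply/seteqP; split => [t [x _] /= <-|t /= /ball_code_bit[x xt]].
  exact: ball_bit_code.
by exists x.
Qed.

(** Induction on the generated sigma-algebra. Complements are taken inside the set of all codes and
    rely on injectivity of the coding; an open set is the union of the countably many rational balls
    it contains, each of which is read off from one digit. *)
Lemma measurable_code_set (A : set P) :
  <<s @open P >> A -> measurable (code_set A).
Proof.
have mT := measurable_code_setT.
move: A; apply: smallest_sub.
  split.
  - rewrite /= [X in measurable X](_ : _ = set0)//.
    by apply/seteqP; split => t // [].
  - move=> A mA /=.
    rewrite [X in measurable X](_ : _ = code_set setT `\` code_set A).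
      exact: measurableD.
    apply/seteqP; split => [t [x [_ nAx] xt]|t [[x _ xt] nA]].
      split; first by exists x.
      by move=> [y Ay yt]; apply: nAx; rewrite (ball_bit_inj x y)// xt.
    by exists x => //; split => // Ax; apply: nA; exists x.
  - move=> F mF /=.
    rewrite [X in measurable X](_ : _ = \bigcup_k code_set (F k)).
      exact: bigcupT_measurable.
    apply/seteqP; split => [t [x [k _ Fx] xt]|t [k _ [x Fx xt]]].
      by exists k => //; exists x.
    by exists x => //; exists k.
move=> A /dist_open oA /=.
rewrite [X in measurable X](_ : _ = code_set setT `&` [set t |
    exists i : nat * rat, ([set y | dist y (xs i.1) < ratr i.2] `<=` A /\
      ball_digit t i.1 i.2)]).
  apply: measurableI => //; apply: measurable_exists => i.
  have [iA|iA] := pselect ([set y | dist y (xs i.1) < ratr i.2] `<=` A).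
    rewrite [X in measurable X](_ : _ = [set t | ball_digit t i.1 i.2]).
      exact: measurable_ball_digit.
    by apply/seteqP; split => t /= => [[]|].
  rewrite [X in measurable X](_ : _ = set0)//.
  by apply/seteqP; split => t // -[].
apply/seteqP; split => [t [x Ax xt]|t /= [[x _ xt] [[n q] /= [iA]]]]; last first.
  by rewrite -xt => xn; exists x => //; exact: iA.
split; first by exists x.
have [e e0 xA] := oA x Ax.
have [q] := @rat_in_itvoo R 0 (e / 2) ltac:(lra).
rewrite in_itv/= => /andP[q0 qe].
have [n xn] := xs_dense x _ q0.
exists (n, q) => /=; split; last by rewrite -xt.
move=> y /= yn; apply: xA => /=.
by have := dist_tri x (xs n) y; rewrite (dist_sym (xs n)); lra.
Qed.

End polish_coding.

Lemma standard_Borel_retract (R : realType) d (T : measurableType d) :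
  standard_Borel R T -> real_retract R T.
Proof.
move=> [P [f [[[D [cD clD]] [dist [d0 dsym dtri dopen dcomp]]] [g fK gK] mT]]].
have [p0 Dp0] : D !=set0.
  have : closure D (f point) by rewrite clD.
  by move=> /(_ setT filterT) [p [? _]]; exists p.
have [xs xs_surj] : exists xs : nat -> P, forall x, D x -> exists n, xs n = x.
  have /pfcard_geP[D0|[h]] := cD; first by rewrite D0 in Dp0.
  exists h => x Dx.
  by have [n _ <-] := @surj _ _ _ _ h x Dx; exists n.
have dense x e : 0 < e -> exists n, dist x (xs n) < e.
  move=> e0.
  have : closure D x by rewrite clD.
  move=> /(_ [set y | dist y x < e]) [].
    apply: open_nbhs_nbhs; split; first exact: open_dist_ball.
    by rewrite /= (d0 x x).2.
  move=> y [Dy /= yx]; have [n ny] := xs_surj y Dy.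
  by exists n; rewrite ny dsym.
(* The chosen point is unique because bits determine points; reals that code nothing go to
   [point]. *)
pose ret (t : R) : T :=
  if pselect (exists x, ball_bit dist xs x = ball_digit t) is left h
  then g (projT1 (cid h)) else point.
pose b k (x : T) :=
  if unpickle k is Some (n, q) then ball_bit dist xs (f x) n q else false.
exists (fun x => cantor_real (b ^~ x)), ret; split.
- apply: measurable_cantor_real => k; rewrite /b.
  case: unpickle => [[n q]|]; last exact: measurable_cst.
  apply: measurable_fun_pred; apply/mT; apply: sub_gen_smallest => /=.
  rewrite [X in open X](_ : _ = [set p | dist p (xs n) < ratr q]).
    exact: open_dist_ball.
  apply/seteqP; split => [_ [x /= xn <-]//|p /= pn].
  by exists (g p); rewrite /ball_bit /= gK.
- move=> _ B mB; rewrite setTI.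
  have mcode := measurable_code_set dist d0 dsym dtri dopen dcomp xs dense.
  have mBc := mcode _ ((mT B).1 mB).
  have mTc : measurable (code_set dist xs setT).
    by apply: mcode; have := (mT setT).1 measurableT;
      congr (<<s _ >> _); apply/seteqP; split => // p _; exists (g p).
  (* The reals that code no point all decode to [point], so they belong to the preimage exactly when
     [B] contains [point]. *)
  rewrite [X in measurable X](_ : _ = code_set dist xs (f @` B) `|`
      (if `[<B point>] then ~` code_set dist xs setT else set0)).
    by apply: measurableU => //; case: asboolP => // _; exact: measurableC.
  apply/seteqP; split => t.
    rewrite /preimage /= /ret; case: pselect => [h|h] Bt.
      left; exists (projT1 (cid h)); last by case: cid.
      by eexists; [exact: Bt|rewrite gK].
    by right; rewrite asboolT// => -[x _ xt]; apply: h; exists x.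
  move=> [[_ [x Bx <-] xt]|]; rewrite /preimage /= /ret.
    case: pselect => [h|[]]; last by exists (f x).
    case: cid => y /= yt.
    suff -> : y = f x by rewrite fK.
    apply: (ball_bit_inj dist d0 dsym dtri xs dense).
    by rewrite yt.
  case: asboolP => // Bp nt; case: pselect => // -[x xt].
  by exfalso; apply: nt; exists x.
- move=> x; rewrite /ret.
  have xt : ball_bit dist xs (f x) = ball_digit (cantor_real (b ^~ x) : R).
    apply/funext => n; apply/funext => q.
    by rewrite /ball_digit ternary_digitK /b pickleK.
  case: pselect => [h|[]]; last by exists (f x).
  case: cid => y /= yt.
  suff -> : y = f x by rewrite fK.
  by apply: (ball_bit_inj dist d0 dsym dtri xs dense); rewrite yt.
Qed.

(** * Lebesgue measure on the unit interval and kernels *)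

Section unit_interval_lambda.
Context {R : realType}.
Local Notation I := (I01 R).
Implicit Types (A : set I) (u : I).

Definition val01 (u : I) : R := sval u.

Lemma val01_inj : injective val01.
Proof. by move=> [x x01] [y y01] /= xy; apply: eq_exist. Qed.

Lemma val01_ge0 u : 0 <= val01 u. Proof. by case: u => x /= /andP[]. Qed.

Lemma val01_le1 u : val01 u <= 1. Proof. by case: u => x /= /andP[]. Qed.

Definition to01 (x : R) : I :=
  if @idP (0 <= x <= 1) is ReflectT h then exist _ x h else point.

Lemma to01K x : 0 <= x <= 1 -> val01 (to01 x) = x.
Proof. by rewrite /to01; case: {-}_ / idP => // h /h. Qed.

Lemma val01K : cancel val01 to01.
Proof. by move=> u; apply: val01_inj; rewrite to01K// val01_ge0 val01_le1. Qed.

Lemma measurable_I01P A :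
  measurable A -> exists2 B, measurable B & A = val01 @^-1` B.
Proof.
move: A; apply: smallest_sub.
  split => /=.
  - by exists set0 => //; rewrite preimage_set0.
  - move=> A [B mB ->]; exists (~` B); first exact: measurableC.
    by rewrite setTD preimage_setC.
  - move=> F mF.
    have [G FG] : {G : nat -> set R & forall n, measurable (G n) /\
                                       F n = val01 @^-1` G n}.
      by apply: (@choice _ _ (fun n G => measurable G /\ F n = val01 @^-1` G))
        => n; have [G mG ->] := mF n; exists G.
    exists (\bigcup_n G n).
      by apply: bigcupT_measurable => n; have [] := FG n.
    rewrite preimage_bigcup; apply: eq_bigcup => // n _.
    by have [] := FG n.
by move=> _ [B mB <-]; exists B => //; rewrite setTI.
Qed.

Lemma measurable_val01 : measurable_fun [set: I] val01.
Proof.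
move=> _ B mB; apply: sub_gen_smallest.
by exists B.
Qed.

Lemma measurable_to01 : measurable_fun [set: R] to01.
Proof.
move=> _ A mA; have [B mB ->] := measurable_I01P A mA.
rewrite setTI -comp_preimage.
rewrite [X in measurable X](_ : _ = (fun x : R => if 0 <= x <= 1 then x else 0)
  @^-1` B).
  rewrite -[X in measurable X]setTI.
  apply: (_ : measurable_fun setT _) => //; apply: measurable_fun_ifT => //.
  by apply: measurable_and; exact: measurable_fun_ler.
congr (_ @^-1` B); apply/funext => x /=; case: ifPn => x01.
  by rewrite to01K.
by rewrite /to01; case: {-}_ / idP => // h; rewrite h in x01.
Qed.

Lemma real_retract_I01 : real_retract R I.
Proof.
exists val01, to01; split.
- exact: measurable_val01.
- exact: measurable_to01.
- exact: val01K.
Qed.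

Lemma lambda01_preimage (B : set R) :
  lambda01 R (val01 @^-1` B) = lebesgue_measure (B `&` `[0, 1]).
Proof.
rewrite /lambda01; congr lebesgue_measure; apply/seteqP; split => [_ [u Bu <-]|x].
  by split => //=; rewrite in_itv /= val01_ge0 val01_le1.
rewrite /= in_itv/= => -[Bx x01]; exists (to01 x); last exact: to01K.
by rewrite /preimage /= to01K.
Qed.

Let lambda01_0 : lambda01 R set0 = 0%E.
Proof. by rewrite /lambda01 image_set0 measure0. Qed.

Let lambda01_ge0 A : (0 <= lambda01 R A)%E.
Proof. exact: measure_ge0. Qed.

Let lambda01_sigma_additive : semi_sigma_additive (lambda01 R).
Proof.
move=> F mF tF mUF; rewrite /lambda01 image_bigcup.
have mim A : measurable A -> measurable (val01 @` A).
  move=> /measurable_I01P[B mB ->].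
  rewrite [X in measurable X](_ : _ = B `&` `[0, 1]); first exact: measurableI.
  apply/seteqP; split => [_ [u Bu <-]|x].
    by split => //=; rewrite in_itv /= val01_ge0 val01_le1.
  rewrite /= in_itv/= => -[Bx x01]; exists (to01 x); last exact: to01K.
  by rewrite /preimage /= to01K.
apply: measure_semi_sigma_additive.
- by move=> n; exact: mim.
- apply/trivIsetP => i j _ _ ij; apply/seteqP; split => // _ [[u Fu <-] [v Fv]].
  move=> /val01_inj uv; move/trivIsetP : tF => /(_ i j Logic.I Logic.I ij).
  by move=> /seteqP[+ _] => /(_ u); apply; split => //; rewrite -uv.
- by apply: bigcupT_measurable => n; exact: mim.
Qed.

HB.instance Definition _ := isMeasure.Build _ _ _ (lambda01 R)
  lambda01_0 lambda01_ge0 lambda01_sigma_additive.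

Let lambda01_setT : lambda01 R setT = 1%E.
Proof.
rewrite -(preimage_setT val01) lambda01_preimage setTI lebesgue_measure_itv/=.
by rewrite lte_fin ltr01 -EFinB subr0.
Qed.

HB.instance Definition _ := Measure_isProbability.Build _ _ _ (lambda01 R)
  lambda01_setT.

Lemma lambda01_le (t : R) : 0 <= t <= 1 ->
  lambda01 R [set u | val01 u <= t] = t%:E.
Proof.
move=> /andP[t0 t1].
rewrite (_ : [set u | val01 u <= t] = val01 @^-1` `]-oo, t]); last first.
  by apply/seteqP; split => u /=; rewrite in_itv.
rewrite lambda01_preimage (_ : _ `&` _ = `[0, t]%classic); last first.
  apply/seteqP; split => x /=; rewrite !in_itv/=; first by case=> -> /andP[->].
  by move=> /andP[-> xt]; rewrite xt (le_trans xt).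
rewrite lebesgue_measure_itv/= lte_fin.
case: ifPn => [_|]; first by rewrite oppr0 adde0.
by rewrite -leNgt => tle0; rewrite (_ : t = 0)//; apply/eqP; rewrite eq_le tle0.
Qed.

Lemma lambda01_cantor : lambda01 R (val01 @^-1` cantor_set) = 0%E.
Proof.
rewrite lambda01_preimage; apply/eqP; rewrite eq_le measure_ge0 andbT.
rewrite -(@cantor_set_null R); apply: measure_subset => //.
  by apply: measurableI => //; exact: measurable_cantor_set.
exact: measurable_cantor_set.
Qed.

Lemma lambda01_point (x : R) : lambda01 R [set u | val01 u = x] = 0%E.
Proof.
rewrite (_ : [set u | _] = val01 @^-1` [set x])//.
rewrite lambda01_preimage; apply/eqP; rewrite eq_le measure_ge0 andbT.
rewrite -(@lebesgue_measure_set1 R x); apply: measure_subset => //.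
exact: measurableI.
Qed.

End unit_interval_lambda.

Section kernel_image.
Context {R : realType} {d d' d''} {W : measurableType d} {T : measurableType d'}
  {T' : measurableType d''} (k : R.-pker W ~> T) (f : W * T -> T').
Hypothesis mf : measurable_fun [set: W * T] f.

Let mfw w : measurable_fun [set: T] (fun t => f (w, t)).
Proof. exact: measurable_fun_pair2. Qed.

(** The map may depend on the parameter. Measurability survives because the preimage of a set under
    [f (w, _)] is a section of a measurable subset of the product. *)
Definition kernel_image (w : W) : {measure set T' -> \bar R} :=
  measure_function_pushforward__canonical__measure_function_Measure (k w) (mfw w).

Lemma kernel_imageE w U : kernel_image w U = k w [set t | U (f (w, t))].
Proof. by []. Qed.

Let measurable_kernel_image U : measurable U ->
  measurable_fun [set: W] (kernel_image ^~ U).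
Proof.
move=> mU.
have mA : measurable (f @^-1` U) by rewrite -[X in measurable X]setTI; exact: mf.
have /= := measurable_fun_xsection_finite_kernel k (mem_set mA).
congr measurable_fun; apply/funext => w; congr (k w _).
by rewrite xsectionE.
Qed.

HB.instance Definition _ :=
  isKernel.Build _ _ _ _ R kernel_image measurable_kernel_image.

Let kernel_image_prob w : kernel_image w setT = 1%E.
Proof. by rewrite kernel_imageE; exact: prob_kernel. Qed.

HB.instance Definition _ := Kernel_isProbability.Build _ _ _ _ R kernel_image
  kernel_image_prob.

End kernel_image.

Section kernel_cst.
Context {R : realType} {d d'} (W : measurableType d) {T : measurableType d'}
  (P : probability T R).

Definition kernel_cst (_ : W) : {measure set T -> \bar R} := P.

HB.instance Definition _ :=
  isKernel.Build _ _ _ _ R kernel_cst (fun U _ => measurable_cst _).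

HB.instance Definition _ := Kernel_isProbability.Build _ _ _ _ R kernel_cst
  (fun _ => probability_setT P).

End kernel_cst.

Section kernel_lambda.
Context {R : realType} {d d'} {W : measurableType d} {T : measurableType d'}
  (k : R.-pker W ~> T).

Definition kernel_lambda (w : W) : {measure set (T * I01 R) -> \bar R} :=
  (k w \x lambda01 R)%E.

Let measurable_kernel_lambda U : measurable U ->
  measurable_fun [set: W] (kernel_lambda ^~ U).
Proof.
move=> mU; apply: (@measurable_fun_integral_kernel _ _ _ _ _ k _
  (lambda01 R \o xsection U)).
- exact: measurable_kernel.
- by move=> t; exact: measure_ge0.
- exact: measurable_fun_xsection.
Qed.

HB.instance Definition _ :=
  isKernel.Build _ _ _ _ R kernel_lambda measurable_kernel_lambda.

Let kernel_lambda_prob w : kernel_lambda w setT = 1%E.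
Proof.
rewrite /kernel_lambda -setXTT [LHS]product_measure1E// prob_kernel mul1e.
exact: probability_setT.
Qed.

HB.instance Definition _ := Kernel_isProbability.Build _ _ _ _ R kernel_lambda
  kernel_lambda_prob.

End kernel_lambda.

Lemma measurable_asbool d (T : measurableType d) d' (T' : measurableType d')
    (f : T -> T') (A : set T') :
  measurable_fun [set: T] f -> measurable A ->
  measurable_fun [set: T] (fun x => `[< A (f x) >]).
Proof.
move=> mf mA; apply: measurable_fun_pred.
rewrite [X in measurable X](_ : _ = f @^-1` A).
  by rewrite -[X in measurable X]setTI; exact: mf.
by apply/seteqP; split => x /= /asboolP.
Qed.

Lemma eq_measure_off_null d (T : measurableType d) (R : realType)
    (mu : {measure set T -> \bar R}) (N A B : set T) :
  measurable N -> measurable A -> measurable B -> mu N = 0%E ->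
  (forall x, ~ N x -> (A x <-> B x)) -> mu A = mu B.
Proof.
move=> mN mA mB N0 AB; apply/eqP; rewrite eq_le; apply/andP; split.
- apply: (@le_trans _ _ (mu (B `|` N))).
    apply: measure_subset => //; first exact: measurableU.
    move=> x Ax; have [Nx|Nx] := pselect (N x); first by right.
    by left; exact/AB.
  by rewrite (le_trans (measureU2 _ mB mN))// [X in (_ + X)%E]N0 adde0.
- apply: (@le_trans _ _ (mu (A `|` N))).
    apply: measure_subset => //; first exact: measurableU.
    move=> x Ax; have [Nx|Nx] := pselect (N x); first by right.
    by left; exact/AB.
  by rewrite (le_trans (measureU2 _ mA mN))// [X in (_ + X)%E]N0 adde0.
Qed.

(** Half-lines are stable under intersection, generate the Borel sets, and those ending at integers
    exhaust the line with finite mass. *)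
Lemma measure_eq_halflines (R : realType) (m1 m2 : {measure set R -> \bar R}) :
  (forall t, (m1 `]-oo, t[%classic < +oo)%E) ->
  (forall t, m1 `]-oo, t[%classic = m2 `]-oo, t[%classic) ->
  forall B, measurable B -> m1 B = m2 B.
Proof.
move=> m1oo m12 B mB.
apply: (measure_unique (@RGenInftyO.G R) (fun n => `]-oo, n%:R[%classic)) => //.
- exact: RGenInftyO.measurableE.
- move=> _ _ [x ->] [y ->]; exists (Num.min x y).
  apply/seteqP; split => z /=; rewrite !in_itv/= lt_min => /=.
    by move=> [-> ->].
  by move=> /andP[].
- by move=> n; exists n%:R.
- apply/seteqP; split => // x _; exists (Num.truncn `|x|).+1 => //=.
  by rewrite in_itv/= (le_lt_trans (ler_norm _))// truncnS_gt.
- by move=> _ [x ->].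
Qed.

Section distribution_continuity.
Context {R : realType} {d} {T : measurableType d} (mu : {measure set T -> \bar R})
  (E : T -> R).
Hypothesis mE : measurable_fun [set: T] E.

Lemma measurable_le_set t : measurable [set x | E x <= t].
Proof. by apply: measurable_fun_true; exact: measurable_fun_ler. Qed.

Lemma measurable_lt_set t : measurable [set x | E x < t].
Proof. by apply: measurable_fun_true; exact: measurable_fun_ltr. Qed.

(** Continuity from below along [t - 1 / (n + 1)]. Quantiles are compared on strict half-lines,
    whereas distribution functions give closed ones; this lemma and the next pass between the
    two. *)
Lemma measure_lt_le (t : R) c :
  (forall t', t' < t -> (mu [set x | (E x <= t')%R] <= c)%E) ->
  (mu [set x | (E x < t)%R] <= c)%E.
Proof.
move=> h; pose A n := [set x | E x <= t - n.+1%:R^-1].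
have UA : \bigcup_n A n = [set x | E x < t].
  apply/seteqP; split => [x [n _] /= xn|x /= xt].
    by rewrite (le_lt_trans xn)// gtrBl invr_gt0.
  have [k xk] := ltr_add_invr xt; exists k => //=.
  by rewrite /A /= lerBrDr ltW.
have cv : mu (A n) @[n --> \oo] --> mu (\bigcup_n A n).
  apply: nondecreasing_cvg_mu.
  - by move=> n; exact: measurable_le_set.
  - by rewrite UA; exact: measurable_lt_set.
  - move=> m n mn; apply/subsetPset => x /= /le_trans; apply.
    by rewrite lerB// lef_pV2 ?posrE// ler_nat.
rewrite -UA -(cvg_lim _ cv)//; apply: lime_le.
  by apply/cvg_ex; eexists; exact: cv.
by apply: nearW => n; apply: h; rewrite gtrBl invr_gt0.
Qed.

Lemma measure_le_ge (t : R) c : (mu setT < +oo)%E ->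
  (forall t', t < t' -> (c <= mu [set x | (E x <= t')%R])%E) ->
  (c <= mu [set x | (E x <= t)%R])%E.
Proof.
move=> fin h; pose A n := [set x | E x <= t + n.+1%:R^-1].
have IA : \bigcap_n A n = [set x | E x <= t].
  apply/seteqP; split => [x /= xA|x /= xt n _]; last first.
    by rewrite /A /= (le_trans xt)// lerDl invr_ge0.
  rewrite leNgt; apply/negP => tx.
  have [k] := ltr_add_invr tx; rewrite ltNge => /negP; apply.
  exact: (xA k).
have mA n : measurable (A n) by exact: measurable_le_set.
have cv : mu (A n) @[n --> \oo] --> mu (\bigcap_n A n).
  apply: nonincreasing_cvg_mu => //.
  - by apply: le_lt_trans fin; exact: measure_subset.
  - by rewrite IA; exact: measurable_le_set.
  - move=> m n mn; apply/subsetPset => x /= /le_trans; apply.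
    by rewrite lerD2l lef_pV2 ?posrE// ler_nat.
rewrite -IA -(cvg_lim _ cv)//; apply: lime_ge.
  by apply/cvg_ex; eexists; exact: cv.
by apply: nearW => n; apply: h; rewrite ltrDl invr_gt0.
Qed.

End distribution_continuity.

(** * Quantile functions of measurable families of distribution functions *)

Section quantile.
Context {R : realType} {d} {W : measurableType d} (D : rat -> W -> R).
Hypotheses (mD : forall q, measurable_fun [set: W] (D q))
  (D01 : forall q w, 0 <= D q w <= 1).

(* Infimum of the rationals 0 <= q < 1 with u <= D q w, and 1 if there is none;
   D need not be monotone in q. *)
Definition quantile_step (n : nat) (p : W * I01 R) : R :=
  let q := rat_seq n in
  if [&& 0 <= q, q < 1 & val01 p.2 <= D q p.1] then ratr q else 1.

Definition quantile (p : W * I01 R) : R := infs (fun n => quantile_step n p) 0.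

Lemma quantile_step_ge0 n p : 0 <= quantile_step n p.
Proof.
by rewrite /quantile_step; case: ifPn => // /and3P[q0 _ _]; rewrite ler0q.
Qed.

Lemma quantile_step_le1 n p : quantile_step n p <= 1.
Proof.
rewrite /quantile_step; case: ifPn => // /and3P[_ q1 _].
by rewrite -[leRHS](rmorph1 (@ratr R)) ler_rat ltW.
Qed.

Lemma quantile_has_inf p : has_inf (sdrop (fun n => quantile_step n p) 0).
Proof.
split; first by exists (quantile_step 0 p); exists 0%N.
by exists 0 => _ [n _ <-]; exact: quantile_step_ge0.
Qed.

Lemma quantile_ge0 p : 0 <= quantile p.
Proof.
apply: lb_le_inf; first by have [] := quantile_has_inf p.
by move=> _ [n _ <-]; exact: quantile_step_ge0.
Qed.

Lemma quantile_le1 p : quantile p <= 1.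
Proof.
apply: (le_trans _ (quantile_step_le1 0 p)); apply: ge_inf.
  by have [] := quantile_has_inf p.
by exists 0%N.
Qed.

(** The usual Galois connection between quantile and distribution function, in a strict form that
    asks for neither monotonicity nor right continuity of [D]. The default value 1 never counts as a
    witness because [t <= 1]. *)
Lemma quantile_ltP p t : t <= 1 -> quantile p < t <->
  exists q : rat, [/\ 0 <= q, ratr q < t & val01 p.2 <= D q p.1].
Proof.
move=> t1; split.
  move=> /(inf_lt (quantile_has_inf p).1)[_ [n _ <-]].
  rewrite /quantile_step; case: ifPn => [/and3P[q0 _ uD] qt|_ /lt_le_trans].
    by exists (rat_seq n).
  by move=> /(_ _ t1); rewrite ltxx.
move=> [q [q0 qt uD]]; have [n nq] := rat_seqP q.
have q1 : q < 1 by rewrite -(ltr_rat R) rmorph1 (lt_le_trans qt).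
apply: le_lt_trans qt; rewrite (_ : ratr q = quantile_step n p).
  by apply: ge_inf; [have [] := quantile_has_inf p|exists n].
by rewrite /quantile_step nq q0 q1 uD.
Qed.

Lemma measurable_quantile : measurable_fun [set: W * I01 R] quantile.
Proof.
apply: measurable_fun_infs.
  by move=> p _; exists 0 => _ [n _ <-]; exact: quantile_step_ge0.
move=> n; rewrite /quantile_step; set q := rat_seq n.
have [q01|q01] := boolP ((0 <= q) && (q < 1)); last first.
  rewrite [X in measurable_fun _ X](_ : _ = cst 1)//.
  by apply/funext => p; rewrite andbA (negbTE q01).
rewrite [X in measurable_fun _ X](_ : _ =
   fun p => if val01 p.2 <= D q p.1 then ratr q else 1); last first.
  by apply/funext => p; rewrite andbA q01.
apply: measurable_fun_ifT => //; apply: measurable_fun_ler.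
  exact: (measurableT_comp measurable_val01 measurable_snd).
exact: (measurableT_comp (mD q) measurable_fst).
Qed.

Lemma measurable_quantile_lt w t :
  measurable [set u : I01 R | quantile (w, u) < t].
Proof.
apply: measurable_fun_true; apply: measurable_fun_ltr => //.
exact: (measurable_fun_pair2 w measurable_quantile).
Qed.

(** With the next lemma this squeezes the mass of a strict half-line between the values [D q w] for
    [q] below [t] and any common upper bound of them. *)
Lemma lambda01_quantile_ge w q t : t <= 1 -> 0 <= q -> ratr q < t ->
  ((D q w)%:E <= lambda01 R [set u | (quantile (w, u) < t)%R])%E.
Proof.
move=> t1 q0 qt; rewrite -(lambda01_le _ (D01 q w)).
apply: measure_subset.
- by apply: measurable_le_set; exact: measurable_val01.
- exact: measurable_quantile_lt.
- by move=> u /= uD; apply/quantile_ltP => //; exists q.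
Qed.

Lemma lambda01_quantile_le w t c : t <= 1 -> 0 <= c <= 1 ->
  (forall q, 0 <= q -> ratr q < t -> D q w <= c) ->
  (lambda01 R [set u | (quantile (w, u) < t)%R] <= c%:E)%E.
Proof.
move=> t1 c01 h; rewrite -(lambda01_le _ c01); apply: measure_subset.
- exact: measurable_quantile_lt.
- by apply: measurable_le_set; exact: measurable_val01.
- move=> u /= /quantile_ltP => /(_ t1)[q [q0 qt /le_trans]]; apply.
  exact: h.
Qed.

End quantile.

(** * Measure preserving isomorphisms *)

(* The parameter w is carried through the usual back-and-forth construction, so
   that the bijection and its inverse are jointly measurable. *)
Section parametric_Schroeder_Bernstein.
Context {R : realType} {dW dA dB} {W : measurableType dW} {A : measurableType dA}
  {B : measurableType dB} (f : W * A -> B) (f' : W * B -> A) (g : W * B -> A)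
  (g' : W * A -> B).
Hypotheses (rA : real_retract R A) (rB : real_retract R B)
  (mf : measurable_fun [set: W * A] f) (mf' : measurable_fun [set: W * B] f')
  (mg : measurable_fun [set: W * B] g) (mg' : measurable_fun [set: W * A] g')
  (fK : forall w a, f' (w, f (w, a)) = a) (gK : forall w b, g' (w, g (w, b)) = b).

(** Stage 0 is the complement of the range of [g], and each stage is the image of the previous one
    under [f] followed by [g]. The left inverses turn membership in a range into an equation, so
    that no image has to be shown Borel. *)
Fixpoint sb_stage (n : nat) : set (W * A) :=
  if n is m.+1 then
    [set p | g (p.1, g' p) = p.2] `&`
    ([set p | f (p.1, f' (p.1, g' p)) = g' p] `&`
     [set p | sb_stage m (p.1, f' (p.1, g' p))])
  else [set p | ~ g (p.1, g' p) = p.2].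

Definition sb_set : set (W * A) := \bigcup_n sb_stage n.

Definition sb_map p : B := if `[< sb_set p >] then f p else g' p.

Definition sb_inv (p : W * B) : A :=
  if `[< sb_set (p.1, g p) >] then f' p else g p.

Let mfst_g' : measurable_fun [set: W * A] (fun p => (p.1, g' p)).
Proof. exact: measurable_fun_pair. Qed.

Let mfst_f'g' : measurable_fun [set: W * A] (fun p => (p.1, f' (p.1, g' p))).
Proof.
apply: measurable_fun_pair => //; exact: measurableT_comp mf' mfst_g'.
Qed.

Lemma measurable_sb_set : measurable sb_set.
Proof.
have mdiag : measurable [set p | g (p.1, g' p) = p.2].
  apply: (real_retract_diag _ _ _ _ _ _ _ rA) => //.
  exact: measurableT_comp mg mfst_g'.
apply: bigcupT_measurable; elim => [|n IH] /=; first exact: measurableC.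
apply: measurableI => //; apply: measurableI.
  apply: (real_retract_diag _ _ _ _ _ _ _ rB) => //.
  exact: measurableT_comp mf mfst_f'g'.
by rewrite -[X in measurable X]setTI; exact: mfst_f'g'.
Qed.

Lemma measurable_sb_map : measurable_fun [set: W * A] sb_map.
Proof.
apply: measurable_fun_ifT => //; apply: measurable_asbool => //.
exact: measurable_sb_set.
Qed.

Lemma measurable_sb_inv : measurable_fun [set: W * B] sb_inv.
Proof.
apply: measurable_fun_ifT => //; apply: measurable_asbool => //.
  exact: measurable_fun_pair.
exact: measurable_sb_set.
Qed.

(** Going through [f] and then [g] raises the stage by one, so the test in [sb_inv] recognises the
    images of [sb_set]. A point off [sb_set] avoids stage 0 and therefore lies in the range of
    [g]. *)
Lemma sb_mapK w a : sb_inv (w, sb_map (w, a)) = a.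
Proof.
rewrite /sb_map; case: asboolP => [[n _ Cn]|nC]; rewrite /sb_inv /=.
  case: asboolP => [_|[]]; first exact: fK.
  by exists n.+1 => //=; rewrite !gK; split => //; split => //=; rewrite fK.
have ga : g (w, g' (w, a)) = a.
  by apply: contrapT => ga; apply: nC; exists 0%N.
by rewrite ga; case: asboolP.
Qed.

Lemma sb_invK w b : sb_map (w, sb_inv (w, b)) = b.
Proof.
rewrite /sb_inv /=; case: asboolP => [[[|n] _ /=]|nC]; rewrite /sb_map.
- by rewrite gK.
- rewrite !gK => -[_ [ffb Cn]].
  by case: asboolP => [_|[]]; [|exists n].
- by rewrite gK; case: asboolP.
Qed.

End parametric_Schroeder_Bernstein.

Section kernel_reparam.
Context {R : realType} {d d' d''} {V : measurableType d} {W : measurableType d'}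
  {T : measurableType d''} (k : R.-pker W ~> T) (g : V -> W).

Definition kernel_reparam (_ : measurable_fun [set: V] g) (v : V) :
  {measure set T -> \bar R} := k (g v).

Variable mg : measurable_fun [set: V] g.

Let measurable_kernel_reparam U : measurable U ->
  measurable_fun [set: V] (kernel_reparam mg ^~ U).
Proof.
by move=> mU; exact: (measurableT_comp (measurable_kernel k U mU) mg).
Qed.

HB.instance Definition _ :=
  isKernel.Build _ _ _ _ R (kernel_reparam mg) measurable_kernel_reparam.

HB.instance Definition _ := Kernel_isProbability.Build _ _ _ _ R
  (kernel_reparam mg) (fun v => prob_kernel (g v)).

End kernel_reparam.

Lemma measurable_kernel_fiber (R : realType) d d' d'' (V : measurableType d)
    (W : measurableType d') (T : measurableType d'') (k : R.-pker W ~> T)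
    (g : V -> W) (A : set (V * T)) :
  measurable_fun [set: V] g -> measurable A ->
  measurable_fun [set: V] (fun v => k (g v) [set t | A (v, t)]).
Proof.
move=> mg mA.
have /= := measurable_fun_xsection_finite_kernel (kernel_reparam k g mg)
  (mem_set mA).
congr measurable_fun; apply/funext => v.
by rewrite xsectionE.
Qed.

Section atomless_isomorphism.
Context {R : realType} {d d'} {W : measurableType d} {S : measurableType d'}
  (m : R.-pker W ~> S).
Variables (E : S -> R) (r : R -> S).
Hypotheses (mE : measurable_fun [set: S] E) (mr : measurable_fun [set: R] r)
  (EK : cancel E r) (Ecantor : forall s, cantor_set (E s)).
Hypothesis m_atomless : forall w t, m w [set s | E s = t] = 0%E.
Variables (N : set S) (iota : I01 R -> S) (iota' : S -> I01 R).
Hypotheses (mN : measurable N) (N0 : forall w, m w N = 0%E)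
  (miota : measurable_fun [set: I01 R] iota)
  (miota' : measurable_fun [set: S] iota') (iotaK : cancel iota iota')
  (iotaN : forall u, N (iota u)).

Let E01 s : 0 <= E s <= 1.
Proof. by have := cantor_set_itv _ (Ecantor s); rewrite /= in_itv. Qed.

Let mle t : measurable [set s | E s <= t]. Proof. exact: measurable_le_set. Qed.
Let mlt t : measurable [set s | E s < t]. Proof. exact: measurable_lt_set. Qed.

Let m1 w : m w setT = 1%E. Proof. exact: prob_kernel. Qed.

Let m_fin w A : measurable A -> m w A \is a fin_num.
Proof.
move=> mA; rewrite ge0_fin_numE ?measure_ge0//.
apply: (@le_lt_trans _ _ (m w setT)); first exact: measure_subset.
by rewrite m1 ltry.
Qed.

Let cdfm (p : W * R) : R := fine (m p.1 [set s | E s <= p.2]).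

Let cdfmE w t : (cdfm (w, t))%:E = m w [set s | E s <= t].
Proof. by rewrite /cdfm fineK// m_fin. Qed.

Let cdfm_le w t t' : t <= t' -> cdfm (w, t) <= cdfm (w, t').
Proof.
move=> tt'; rewrite -lee_fin !cdfmE; apply: measure_subset => // s /= st.
exact: le_trans st tt'.
Qed.

Let cdfm01 w t : 0 <= cdfm (w, t) <= 1.
Proof.
rewrite -!lee_fin cdfmE measure_ge0/= -(m1 w); exact: measure_subset.
Qed.

Let cdfm_1 w t : 1 <= t -> cdfm (w, t) = 1.
Proof.
move=> t1; rewrite /cdfm (_ : [set s | _] = setT) ?m1//=.
apply/seteqP; split => // s _ /=; apply: le_trans t1.
by have /andP[] := E01 s.
Qed.

Let mcdfm : measurable_fun [set: W * R] cdfm.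
Proof.
apply: (measurableT_comp (fine_measurable measurableT)) => /=.
apply: (@measurable_kernel_fiber _ _ _ _ _ _ _ m fst
  [set p : (W * R) * S | E p.2 <= p.1.2]) => //.
apply: measurable_fun_true; apply: measurable_fun_ler.
  exact: (measurableT_comp mE measurable_snd).
exact: (measurableT_comp measurable_snd measurable_fst).
Qed.

Let D (q : rat) (w : W) : R := cdfm (w, ratr q).

Let mD q : measurable_fun [set: W] (D q).
Proof. by apply: (measurableT_comp mcdfm); exact: measurable_fun_pair. Qed.

Let D01 q w : 0 <= D q w <= 1. Proof. exact: cdfm01. Qed.

Let Q := quantile D.

Let mQ : measurable_fun [set: W * I01 R] Q. Proof. exact: measurable_quantile. Qed.

Let mQw w : measurable_fun [set: I01 R] (fun u => Q (w, u)).
Proof. exact: (measurable_fun_pair2 w mQ). Qed.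

(** Any level [t'] below [t] is dominated by a rational one still below [t]. Negative levels carry
    no mass because codes are nonnegative, and [q = 0] serves there, which is where [0 < t]
    enters. *)
Let cdfm_lt_ge w t : 0 < t -> t <= 1 -> forall c,
  (forall q, 0 <= q -> ratr q < t -> ((D q w)%:E <= c)%E) ->
  (m w [set s | (E s < t)%R] <= c)%E.
Proof.
move=> t0 t1 c h; apply: measure_lt_le => // t' t't.
have [t'0|t'0] := ltP t' 0.
  have -> : [set s | E s <= t'] = set0.
    apply/seteqP; split => // s /= st'.
    by have /andP[] := E01 s; rewrite leNgt (le_lt_trans st').
  rewrite measure0; apply: le_trans (h 0 (lexx _) _); last by rewrite rmorph0.
  by rewrite lee_fin; have /andP[] := D01 0 w.
have [q] := rat_in_itvoo t't; rewrite in_itv/= => /andP[t'q qt].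
apply: le_trans (h q _ qt); last by rewrite -(ler_rat R) rmorph0 (le_trans t'0)// ltW.
by rewrite -cdfmE lee_fin; apply: cdfm_le; rewrite ltW.
Qed.

Let quantile_halfline w t :
  lambda01 R [set u | Q (w, u) < t] = m w [set s | E s < t].
Proof.
have [t0|t0] := leP t 0.
  rewrite (_ : [set u | _] = set0); last first.
    apply/seteqP; split => // u /= ut.
    by have := quantile_ge0 D (w, u); rewrite leNgt (lt_le_trans ut).
  rewrite (_ : [set s | _] = set0) ?measure0//.
  apply/seteqP; split => // s /= st.
  by have /andP[] := E01 s; rewrite leNgt (lt_le_trans st).
have [t1|t1] := leP t 1; last first.
  rewrite (_ : [set u | _] = setT); last first.
    apply/seteqP; split => // u _ /=.
    exact: le_lt_trans (quantile_le1 D (w, u)) t1.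
  rewrite (_ : [set s | _] = setT) ?m1//; first exact: probability_setT.
  apply/seteqP; split => // s _ /=; apply: le_lt_trans t1.
  by have /andP[] := E01 s.
apply/eqP; rewrite eq_le; apply/andP; split.
  rewrite -[leRHS]fineK ?m_fin//; apply: lambda01_quantile_le => //.
    rewrite -!lee_fin fineK ?m_fin// measure_ge0/= -(m1 w).
    exact: measure_subset.
  move=> q q0 qt; rewrite -lee_fin.
  rewrite (_ : (D q w)%:E = m w [set s | E s <= ratr q]); last exact: cdfmE.
  rewrite fineK ?m_fin//.
  by apply: measure_subset => // s /= /le_lt_trans; apply.
apply: cdfm_lt_ge => // q q0 qt.
exact: lambda01_quantile_ge.
Qed.

Let quantile_law w (B : set R) : measurable B ->
  lambda01 R [set u | B (Q (w, u))] = m w [set s | B (E s)].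
Proof.
have e1 (t : R) : [set u | Q (w, u) \in `]-oo, t[] = [set u | Q (w, u) < t].
  by apply/seteqP; split => u /=; rewrite in_itv.
have e2 (t : R) : [set s | E s \in `]-oo, t[] = [set s | E s < t].
  by apply/seteqP; split => s /=; rewrite in_itv.
apply: (measure_eq_halflines R
  (measure_function_pushforward__canonical__measure_function_Measure
     (lambda01 R) (mQw w))
  (measure_function_pushforward__canonical__measure_function_Measure
     (m w) mE)) => t; rewrite /= /pushforward /preimage /= e1.
  by rewrite quantile_halfline -ge0_fin_numE ?m_fin.
by rewrite quantile_halfline e2.
Qed.

(** Without atoms the closed and the open half-line at the quantile have equal mass. The open one
    has mass at most [u] because no rational level below the quantile reaches [u]; the closed one
    has mass at least [u] by continuity from above. *)
Let cdfm_quantile w u : 0 < val01 u -> cdfm (w, Q (w, u)) = val01 u.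
Proof.
move=> u0; set t := Q (w, u); apply/eqP; rewrite eq_le; apply/andP; split.
  rewrite -lee_fin cdfmE.
  have -> : m w [set s | E s <= t] = m w [set s | E s < t].
    apply: (eq_measure_off_null _ _ _ _ [set s | E s = t]) => //.
      rewrite (_ : [set s | _] = [set s | E s == t]).
        by apply: measurable_fun_true; exact: measurable_fun_eqr.
      by apply/seteqP; split => s /= /eqP.
    by move=> s /= /eqP Est; rewrite lt_neqAle Est.
  have t1 : t <= 1 by exact: quantile_le1.
  have [t0|t0] := leP t 0.
    rewrite (_ : [set s | _] = set0) ?measure0 ?lee_fin ?val01_ge0//.
    apply/seteqP; split => // s /= st.
    by have /andP[] := E01 s; rewrite leNgt (lt_le_trans st).
  apply: cdfm_lt_ge => // q q0 qt; rewrite lee_fin leNgt; apply/negP => /ltW uD.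
  have : Q (w, u) < t by apply/quantile_ltP => //; exists q.
  by rewrite ltxx.
rewrite -lee_fin cdfmE; apply: measure_le_ge => //; first by rewrite m1 ltry.
move=> t' tt'; rewrite -cdfmE lee_fin.
have [t'1|t'1] := leP t' 1; last first.
  by rewrite (cdfm_1 w t' (ltW t'1)); exact: val01_le1.
have /quantile_ltP : Q (w, u) < t' by [].
move=> /(_ t'1)[q [q0 qt' /le_trans]]; apply.
by apply: cdfm_le; exact: ltW.
Qed.

(* The injection f follows the quantile map where it is invertible and avoids
   the null set N; the other points are sent into N by iota. *)
Let good (p : W * I01 R) : bool :=
  [&& cdfm (p.1, Q p) == val01 p.2, E (r (Q p)) == Q p &
      ~~ `[< N (r (Q p)) >]].

Let mrQ : measurable_fun [set: W * I01 R] (r \o Q).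
Proof. exact: measurableT_comp mr mQ. Qed.

Let mgood : measurable_fun [set: W * I01 R] good.
Proof.
apply: measurable_and.
  apply: measurable_fun_eqr.
    apply: (measurableT_comp mcdfm); exact: measurable_fun_pair.
  exact: (measurableT_comp measurable_val01 measurable_snd).
apply: measurable_and.
  apply: measurable_fun_eqr => //; exact: (measurableT_comp mE mrQ).
by apply: measurable_neg; exact: measurable_asbool.
Qed.

Let f p : S := if good p then r (Q p) else iota p.2.

Let f' (p : W * S) : I01 R :=
  if `[< N p.2 >] then iota' p.2 else to01 (cdfm (p.1, E p.2)).

Let mf : measurable_fun [set: W * I01 R] f.
Proof.
apply: measurable_fun_ifT => //.
exact: (measurableT_comp miota measurable_snd).
Qed.

Let mf' : measurable_fun [set: W * S] f'.
Proof.
apply: measurable_fun_ifT; first exact: measurable_asbool.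
  exact: (measurableT_comp miota' measurable_snd).
apply: (measurableT_comp measurable_to01); apply: (measurableT_comp mcdfm).
apply: measurable_fun_pair => //.
exact: (measurableT_comp mE measurable_snd).
Qed.

Let fK w u : f' (w, f (w, u)) = u.
Proof.
rewrite /f; case: ifPn => [/and3P[/= /eqP FQ /eqP EQ nN]|_]; rewrite /f' /=.
  by rewrite (negbTE nN) EQ FQ val01K.
by rewrite asboolT// iotaK.
Qed.

(** The failures are [u = 0], quantiles that are not codes, and quantiles that decode into [N]. The
    first is a single point; [quantile_law] transports the other two to [S], where they become the
    empty set and the null set [N]. *)
Let good_ae w : lambda01 R [set u | ~~ good (w, u)] = 0%E.
Proof.
pose A1 := [set u : I01 R | val01 u = 0].
pose A2 := [set u | E (r (Q (w, u))) != Q (w, u)].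
pose A3 := [set u | N (r (Q (w, u)))].
have mA1 : measurable A1.
  rewrite [X in measurable X](_ : _ = [set u | val01 u == 0]).
    apply: measurable_fun_true; apply: measurable_fun_eqr => //.
    exact: measurable_val01.
  by apply/seteqP; split => u /= /eqP.
have mne : measurable [set x | E (r x) != x].
  apply: measurable_fun_true; apply: measurable_neg.
  by apply: measurable_fun_eqr => //; exact: measurableT_comp mE mr.
have mNr : measurable [set x | N (r x)].
  by rewrite -[X in measurable X]setTI; exact: mr.
have mA2 : measurable A2.
  by rewrite -[X in measurable X]setTI; exact: (mQw w measurableT _ mne).
have mA3 : measurable A3.
  by rewrite -[X in measurable X]setTI; exact: (mQw w measurableT _ mNr).
have A10 : lambda01 R A1 = 0%E by exact: lambda01_point.
have A20 : lambda01 R A2 = 0%E.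
  rewrite (quantile_law w _ mne) (_ : [set s | _] = set0) ?measure0//.
  by apply/seteqP; split => // s /=; rewrite EK eqxx.
have A30 : lambda01 R A3 = 0%E.
  rewrite (quantile_law w _ mNr) -[RHS](N0 w); congr (m w _).
  by apply/seteqP; split => s /=; rewrite EK.
apply/eqP; rewrite eq_le measure_ge0 andbT.
apply: (@le_trans _ _ (lambda01 R (A1 `|` A2 `|` A3))).
  apply: measure_subset.
  - apply: measurable_fun_true; apply: measurable_neg.
    exact: (measurable_fun_pair2 w mgood).
  - by apply: measurableU => //; exact: measurableU.
  - move=> u /=; apply: contraNP => nA; apply/and3P; split => /=.
    + apply/eqP/cdfm_quantile; rewrite lt_neqAle val01_ge0 andbT.
      by apply/negP => /eqP u0; apply: nA; left; left.
    + by apply/negPn/negP => h; apply: nA; left; right.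
    + by apply/asboolPn => h; apply: nA; right.
apply: (le_trans (measureU2 _ _ mA3)); first exact: measurableU.
rewrite [X in (_ + X <= _)%E]A30 adde0.
apply: (le_trans (measureU2 _ mA1 mA2)).
by rewrite [X in (X + _ <= _)%E]A10 [X in (_ + X <= _)%E]A20 adde0.
Qed.

(** Almost surely [f] is the decoded quantile. The quantile has the law of [E] under [m w], and
    decoding undoes [E]. *)
Let f_law w (B : set S) : measurable B ->
  lambda01 R [set u | B (f (w, u))] = m w B.
Proof.
move=> mB; have mrB : measurable [set x | B (r x)].
  by rewrite -[X in measurable X]setTI; exact: mr.
rewrite -[RHS](_ : lambda01 R [set u | B (r (Q (w, u)))] = _); last first.
  rewrite (quantile_law w _ mrB); congr (m w _).
  by apply/seteqP; split => s /=; rewrite EK.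
apply: (eq_measure_off_null _ _ _ _ [set u | ~~ good (w, u)]).
- apply: measurable_fun_true; apply: measurable_neg.
  exact: (measurable_fun_pair2 w mgood).
- exact: (measurable_set_comp _ _ _ _ _ _ (measurable_fun_pair2 w mf) mB).
- exact: (measurable_set_comp _ _ _ _ _ _ (measurable_fun_pair2 w mrQ) mB).
- exact: good_ae.
- by move=> u /= /negP; rewrite negbK /f => ->.
Qed.

Let K : set (I01 R) := val01 @^-1` cantor_set.

Let mK : measurable K.
Proof.
rewrite -[X in measurable X]setTI.
apply: measurable_val01 => //; exact: measurable_cantor_set.
Qed.

Let rS : real_retract R S. Proof. by exists E, r. Qed.

(* Symmetrically, g is the inverse of f except that it reserves the Cantor set
   for the points where f cannot be inverted; hence g' = f off K. *)
Let goodg : set (W * S) :=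
  [set p | f (p.1, f' p) = p.2] `&` [set p | ~ K (f' p)].

Let mgoodg : measurable goodg.
Proof.
apply: measurableI.
  apply: (real_retract_diag _ _ _ _ _ _ _ rS) => //.
  apply: (measurableT_comp mf); exact: measurable_fun_pair.
by rewrite -[X in measurable X]setTI; exact: (mf' measurableT _ (measurableC mK)).
Qed.

Let g (p : W * S) : I01 R := if `[< goodg p >] then f' p else to01 (E p.2).

Let g' (p : W * I01 R) : S := if `[< K p.2 >] then r (val01 p.2) else f p.

Let mg : measurable_fun [set: W * S] g.
Proof.
apply: measurable_fun_ifT => //; first exact: (measurable_asbool _ _ _ _ id).
apply: (measurableT_comp measurable_to01).
exact: (measurableT_comp mE measurable_snd).
Qed.

Let mg' : measurable_fun [set: W * I01 R] g'.
Proof.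
apply: measurable_fun_ifT => //.
  exact: (measurable_asbool _ _ _ _ snd _ measurable_snd mK).
apply: (measurableT_comp mr).
exact: (measurableT_comp measurable_val01 measurable_snd).
Qed.

Let gK w s : g' (w, g (w, s)) = s.
Proof.
rewrite /g; case: asboolP => [[/= fs nKs]|_]; rewrite /g' /=.
  by rewrite asboolF.
by rewrite asboolT ?to01K// /K /preimage /= to01K.
Qed.

(** Off the null set [K] the maps [g'] and [f] agree, so both branches of [sb_map] equal [f] there
    and the bijection inherits the law of [f]. *)
Lemma atomless_kernel_isomorphism :
  exists (a : W * I01 R -> S) (b : W * S -> I01 R),
    [/\ measurable_fun [set: W * I01 R] a, measurable_fun [set: W * S] b,
        (forall w u, b (w, a (w, u)) = u), (forall w s, a (w, b (w, s)) = s) &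
        forall w B, measurable B ->
          lambda01 R [set u | B (a (w, u))] = m w B].
Proof.
have rI := @real_retract_I01 R.
exists (sb_map f f' g g'), (sb_inv f f' g g').
have ma := measurable_sb_map f f' g g' rI rS mf mf' mg mg'.
split => //.
- exact: (measurable_sb_inv f f' g g' rI rS).
- by move=> w u; exact: sb_mapK.
- by move=> w s; exact: sb_invK.
move=> w B mB; rewrite -(f_law w B mB).
apply: (eq_measure_off_null _ _ _ _ K).
- exact: mK.
- exact: (measurable_set_comp _ _ _ _ _ _ (measurable_fun_pair2 w ma) mB).
- exact: (measurable_set_comp _ _ _ _ _ _ (measurable_fun_pair2 w mf) mB).
- exact: lambda01_cantor.
- move=> u nKu /=; rewrite /sb_map; case: asboolP => // _.
  by rewrite /g' /= asboolF.
Qed.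

End atomless_isomorphism.

Section kernel_isomorphism.
Context {R : realType} {d d'} {W : measurableType d} {Y : measurableType d'}
  (k : R.-pker W ~> Y).
Hypothesis rY : real_retract R Y.

(** A single point of the product lies in a slice with fixed second coordinate, which is null
    whatever [k] is: this gives atomlessness. The null set that absorbs exceptions is the product of
    [Y] with the Cantor set, and [0, 1] embeds in it over the base point of [Y] through its own
    Cantor coding. *)
Lemma kernel_isomorphism :
  exists (a : W * I01 R -> Y * I01 R) (b : W * (Y * I01 R) -> I01 R),
    [/\ measurable_fun [set: W * I01 R] a,
        measurable_fun [set: W * (Y * I01 R)] b,
        (forall w u, b (w, a (w, u)) = u), (forall w s, a (w, b (w, s)) = s) &
        forall w B, measurable B ->
          lambda01 R [set u | B (a (w, u))] = (k w \x lambda01 R)%E B].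
Proof.
have rI := @real_retract_I01 R.
have rYI : real_retract R (Y * I01 R)%type by exact: real_retract_prod.
have [E [r [mE mr EK Ec]]] := real_retract_cantor _ _ _ rYI.
have [e [e' [me me' eK ec]]] := real_retract_cantor _ _ _ rI.
have null (A : set (I01 R)) : measurable A -> lambda01 R A = 0%E ->
    forall w, kernel_lambda k w (setT `*` A) = 0%E.
  by move=> mA A0 w; rewrite [LHS]product_measure1E// [X in (_ * X)%E]A0 mule0.
have mK : measurable (val01 @^-1` (@cantor_set R)).
  by apply: measurable_set_comp; [exact: measurable_val01|exact: measurable_cantor_set].
pose iota u : Y * I01 R := (point, to01 (e u)).
pose iota' (s : Y * I01 R) : I01 R := e' (val01 s.2).
apply: (atomless_kernel_isomorphism (kernel_lambda k) E r mE mr EK Ec _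
  (setT `*` (val01 @^-1` (@cantor_set R))) iota iota').
- move=> w t; pose A := [set v : I01 R | val01 v = val01 (r t).2].
  have mA : measurable A.
    rewrite [X in measurable X](_ : _ = [set v | val01 v == val01 (r t).2]).
      apply: measurable_fun_true; apply: measurable_fun_eqr => //.
      exact: measurable_val01.
    by apply/seteqP; split => v /= /eqP.
  apply/eqP; rewrite eq_le measure_ge0 andbT.
  rewrite -(null A mA (lambda01_point _) w); apply: measure_subset.
  + rewrite [X in measurable X](_ : _ = [set s | E s == t]).
      by apply: measurable_fun_true; exact: measurable_fun_eqr.
    by apply/seteqP; split => v /= /eqP.
  + exact: measurableX.
  + by move=> s Es; split => //=; rewrite /A /= -Es EK.
- exact: measurableX.
- by apply: null => //; exact: lambda01_cantor.
- apply: measurable_fun_pair => //.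
  exact: (measurableT_comp measurable_to01 me).
- exact: (measurableT_comp me' (measurableT_comp measurable_val01 measurable_snd)).
- move=> u; rewrite /iota' /iota /= to01K ?eK//.
  by have := cantor_set_itv _ (ec u); rewrite /= in_itv.
- move=> u; split => //; rewrite /preimage /= to01K//.
  by have := cantor_set_itv _ (ec u); rewrite /= in_itv.
Qed.

End kernel_isomorphism.

(** * Disintegration *)

Lemma limn_esup_le (R : realType) (u v : (\bar R)^nat) :
  (forall n, (u n <= v n)%E) -> (limn_esup u <= limn_esup v)%E.
Proof.
move=> uv; rewrite !limn_esup_lim; apply: lee_lim; [exact: is_cvg_esups..|].
apply: nearW => n; apply: ge_ereal_sup => _ [k kn <-].
by apply: le_trans (uv k) _; apply: ereal_sup_ubound; exists k.
Qed.

Lemma limn_esup_cst (R : realType) (c : \bar R) : limn_esup (fun=> c) = c.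
Proof.
by rewrite is_cvg_limn_esupE; [exact: lim_cst|apply/cvg_ex; exists c; exact: cvg_cst].
Qed.

(** * Differentiation of measures along shrinking balls *)

Section lebesgue_density.
Context {R : realType}.
Implicit Types nu : {measure set (measurableTypeR R) -> \bar R}.

(** The factor is the inverse of the length [2 / (n + 1)] of the ball. The upper limit makes the
    density defined at every point and monotone in [nu]. *)
Definition ball_density nu (s : R) : \bar R :=
  limn_esup (fun n => ((n.+1%:R / 2)%:E * nu (ball s (n.+1%:R^-1)))%E).

Lemma ball_density_ge0 nu s : (0 <= ball_density nu s)%E.
Proof.
rewrite -[leLHS](limn_esup_cst R 0%E); apply: limn_esup_le => n.
by rewrite mule_ge0// lee_fin divr_ge0.
Qed.

Lemma ball_density_le nu nu' s :
  (forall B, measurable B -> (nu B <= nu' B)%E) ->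
  (ball_density nu s <= ball_density nu' s)%E.
Proof.
move=> h; apply: limn_esup_le => n; apply: lee_wpmul2l.
  by rewrite lee_fin divr_ge0.
by apply: h; exact: measurable_ball.
Qed.

Lemma ball_density_le1 nu s :
  (forall B, measurable B -> (nu B <= lebesgue_measure B)%E) ->
  (ball_density nu s <= 1)%E.
Proof.
move=> h; rewrite -[leRHS](limn_esup_cst R 1%E); apply: limn_esup_le => n.
apply: (@le_trans _ _ ((n.+1%:R / 2)%:E *
    lebesgue_measure (ball s (n.+1%:R^-1)))%E).
  apply: lee_wpmul2l; first by rewrite lee_fin divr_ge0.
  by apply: h; exact: measurable_ball.
rewrite lebesgue_measure_ball// -EFinM lee_fin.
have : n.+1%:R != 0 :> R by [].
move: (n.+1%:R) => x x0; rewrite (_ : _ * _ = 1)//.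
by rewrite -mulr_natr; field.
Qed.

(** Domination by Lebesgue measure gives a Radon-Nikodym derivative. At almost every point its
    averages over the balls converge to it by Lebesgue differentiation, and there the upper limit is
    this limit. *)
Lemma integral_ball_density nu :
  (forall B, measurable B -> (nu B <= lebesgue_measure B)%E) ->
  (nu setT < +oo)%E ->
  measurable_fun [set: R] (ball_density nu) ->
  forall A : set R, measurable A ->
  (\int[lebesgue_measure]_(x in A) ball_density nu x)%E = nu A.
Proof.
move=> nule nuoo mnu A mA.
pose nu' : {finite_measure set (measurableTypeR R) -> \bar R} :=
   mfrestr measurableT nuoo.
have nu'E B : nu' B = nu B by rewrite /nu' /= /mfrestr /mrestr setIT.
have dom : nu' `<< (@lebesgue_measure R).
  move=> N N0 C mC CN; apply/eqP; rewrite nu'E eq_le measure_ge0 andbT.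
  by rewrite -(N0 C mC CN); exact: nule.
have [f [f0 ffin fint fE]] :=
  @radon_nikodym_sigma_finite _ (measurableTypeR R) R lebesgue_measure nu' dom.
rewrite -nu'E fE//; apply: ge0_ae_eq_integral => //.
- exact: measurable_funS mnu.
- by apply: measurable_funS (measurable_int _ fint).
- by move=> x _; exact: ball_density_ge0.
pose g x := fine (f x).
have gf : EFin \o g = f by apply/funext => x /=; rewrite /g fineK.
have lg : locally_integrable setT g.
  by apply: open_integrable_locally; [exact: openT|rewrite gf].
pose E (x : R) (n : nat) : set R := ball x (n.+1%:R^-1).
have nE x : nicely_shrinking x (E x).
  split; first by move=> n; exact: measurable_ball.
  exists (1, fun n => PosNum (ltac:(by rewrite invr_gt0 ltr0Sn) : 0 < (n.+1%:R^-1 : R))).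
  split => //=; first exact: cvg_harmonic.
  - by move=> n y; exact.
  - by move=> n; rewrite mul1e.
have := lebesgue_differentiation lg; apply: filter_app.
  exact: (ae_filter_ringOfSetsType lebesgue_measure).
apply: aeW => x xg _.
have cv := nice_lebesgue_differentiation nE lg xg.
rewrite /ball_density -(fineK (ffin x)) -/(g x) -(cvg_lim _ cv)//.
rewrite -is_cvg_limn_esupE; last by apply/cvg_ex; eexists; exact: cv.
congr limn_esup; apply/funext => n; congr (_ * _)%E.
  rewrite lebesgue_measure_ball// inver mulrn_eq0/= invr_eq0 pnatr_eq0/=.
  congr (_%:E); have : n.+1%:R != 0 :> R by [].
  by move: (n.+1%:R) => y y0; rewrite -mulr_natr; field.
rewrite -nu'E fE//; last exact: measurable_ball.
by apply: eq_integral => y _; rewrite -gf.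
Qed.

End lebesgue_density.

Lemma integral_lambda01 (R : realType) (B : set R) (h : R -> \bar R) :
  measurable B -> B `<=` `[0, 1] -> measurable_fun [set: R] h ->
  (forall x, 0 <= h x)%E ->
  (\int[lambda01 R]_(v in val01 @^-1` B) h (val01 v) =
   \int[lebesgue_measure]_(x in B) h x)%E.
Proof.
move=> mB B01 mh h0.
pose m : {measure set (measurableTypeR R) -> \bar R} :=
  @measure_function_pushforward__canonical__measure_function_Measure
     _ _ _ (measurableTypeR R) _ (lambda01 R) val01 (@measurable_val01 R).
transitivity (\int[m]_(x in B) h x)%E.
  apply/esym; apply: (@ge0_integral_pushforward _ _ _ (measurableTypeR R) R
    val01 (@measurable_val01 R) (lambda01 R)) => //.
  exact: measurable_funS mh.
apply: eq_measure_integral => A mA AB.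
rewrite /m /= /pushforward lambda01_preimage setIidl//.
by move=> x /AB; exact: B01.
Qed.

Lemma kernel_lambda_image {R : realType} {d d' d''} {W : measurableType d}
    {T : measurableType d'} {T' : measurableType d''} (k : R.-pker W ~> T)
    (f : W * T -> T') (mf : measurable_fun [set: W * T] f) w
    (C : set (T' * I01 R)) : measurable C ->
  kernel_lambda (kernel_image k f mf) w C =
  kernel_lambda k w [set s | C (f (w, s.1), s.2)].
Proof.
move=> mC.
have mfw : measurable_fun [set: T] (fun t => f (w, t)) by exact: measurable_fun_pair2.
rewrite [LHS](ge0_integral_pushforward mfw)//.
exact: measurable_fun_xsection.
Qed.

Lemma product_lambda01_restr {R : realType} {d} {T : measurableType d}
    (m : {measure set T -> \bar R}) (A : set T) (S : set (T * I01 R)) :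
  (m \x lambda01 R)%E [set p | A p.1 /\ S p] =
  (\int[m]_(t in A) lambda01 R [set u | S (t, u)])%E.
Proof.
rewrite integral_mkcond; apply: eq_integral => t _ /=; rewrite patchE.
case: ifPn => [/set_mem At|/negP nAt].
  congr (lambda01 R _); rewrite xsectionE; apply/seteqP.
  by split => u /= => [[]|].
rewrite (_ : xsection _ _ = set0) ?measure0// xsectionE.
by apply/seteqP; split => u //= [At]; exfalso; apply: nAt; exact/mem_set.
Qed.

(* Under Pi^z the variable pos is uniform; dens B is a version of the
   conditional probability of B given pos, chosen monotone in B everywhere. *)
Section conditional_density.
Context {R : realType} {dZ dS} {Z : measurableType dZ} {S : measurableType dS}
  (Pi : R.-pker Z ~> S).
Local Notation I := (I01 R).
Local Notation lam := (lambda01 R).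
Variable pos : Z * S -> I.
Hypotheses (mpos : measurable_fun [set: Z * S] pos)
  (pos_law : forall z A, measurable A -> Pi z [set s | A (pos (z, s))] = lam A).

Let mposz z : measurable_fun [set: S] (fun s => pos (z, s)).
Proof. exact: (measurable_fun_pair2 z mpos). Qed.

Let mvpos z : @measurable_fun _ _ _ (measurableTypeR R) [set: S]
  (fun s => val01 (pos (z, s))).
Proof. exact: (measurableT_comp measurable_val01 (mposz z)). Qed.

Let nu z B (mB : measurable B) : {measure set (measurableTypeR R) -> \bar R} :=
  @measure_function_pushforward__canonical__measure_function_Measure
    _ _ _ (measurableTypeR R) _ (mrestr (Pi z) mB) _ (mvpos z).

Let nuE z B (mB : measurable B) A :
  nu z B mB A = Pi z [set s | A (val01 (pos (z, s))) /\ B s].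
Proof. by []. Qed.

Let measurable_pos z A B : measurable A -> measurable B ->
  measurable [set s | A (pos (z, s)) /\ B s].
Proof.
move=> mA mB; apply: measurableI => //.
exact: (measurable_set_comp _ _ _ _ _ _ (mposz z) mA).
Qed.

(** Uniformity of [pos] enters here: restricting to [B] only lowers a law that is Lebesgue measure
    on [0, 1]. Both absolute continuity and the bound 1 on densities follow. *)
Let nu_le z B (mB : measurable B) (A : set R) : measurable A ->
  (nu z B mB A <= lebesgue_measure A)%E.
Proof.
move=> mA; have mvA : measurable (val01 @^-1` A).
  by apply: measurable_set_comp mA; exact: measurable_val01.
apply: (@le_trans _ _ (lam (val01 @^-1` A))).
  rewrite nuE -(pos_law z _ mvA); apply: measure_subset.
  - exact: (measurable_pos z _ B mvA mB).
  - exact: (measurable_set_comp _ _ _ _ _ _ (mposz z) mvA).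
  - by move=> s [].
by rewrite lambda01_preimage; apply: measure_subset => //; exact: measurableI.
Qed.

Let nu_fin z B (mB : measurable B) : (nu z B mB setT < +oo)%E.
Proof.
rewrite nuE; apply: (@le_lt_trans _ _ (Pi z setT)).
  by apply: measure_subset => //; exact: (measurable_pos z setT B).
by rewrite prob_kernel ltry.
Qed.

(** The mass of the ball around [x] is the kernel measure of a fibre of one measurable set in
    [(z, x, s)], hence jointly measurable in [z] and [x]. *)
Let mdens B (mB : measurable B) :
  measurable_fun [set: Z * R] (fun p => ball_density (nu p.1 B mB) p.2).
Proof.
apply: measurable_fun_limn_esup => n; apply: measurable_funeM.
apply: (@measurable_kernel_fiber _ _ _ _ _ _ _ Pi fst
  [set q : (Z * R) * S |
    ball q.1.2 (n.+1%:R^-1) (val01 (pos (q.1.1, q.2))) /\ B q.2]) => //.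
apply: measurableI; last first.
  exact: (measurable_set_comp _ _ _ _ snd _ measurable_snd mB).
apply: (@measurable_fun_true _ _ (fun q : (Z * R) * S =>
  `|q.1.2 - val01 (pos (q.1.1, q.2))| < n.+1%:R^-1)).
apply: measurable_fun_ltr => //; apply: measurableT_comp => //.
apply: measurable_funB.
  exact: (measurableT_comp measurable_snd measurable_fst).
apply: (measurableT_comp measurable_val01); apply: (measurableT_comp mpos).
apply: measurable_fun_pair => //.
exact: (measurableT_comp measurable_fst measurable_fst).
Qed.

Let dens_ge0 z B (mB : measurable B) x : (0 <= ball_density (nu z B mB) x)%E.
Proof. exact: ball_density_ge0. Qed.

Let dens_le1 z B (mB : measurable B) x : (ball_density (nu z B mB) x <= 1)%E.
Proof. by apply: ball_density_le1 => A mA; exact: nu_le. Qed.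

Let dens_fin z B (mB : measurable B) x :
  ball_density (nu z B mB) x \is a fin_num.
Proof.
by rewrite ge0_fin_numE// (le_lt_trans (dens_le1 _ _ _ _))// ltry.
Qed.

Lemma conditional_density :
  exists dens : forall B : set S, measurable B -> Z * I -> R,
  [/\ (forall B mB, measurable_fun [set: Z * I] (dens B mB)),
      (forall B mB p, 0 <= dens B mB p <= 1),
      (forall B B' mB mB' p, B `<=` B' -> dens B mB p <= dens B' mB' p) &
      forall B mB z A, measurable A ->
        (\int[lam]_(v in A) (dens B mB (z, v))%:E)%E =
        Pi z [set s | A (pos (z, s)) /\ B s]].
Proof.
exists (fun B mB p => fine (ball_density (nu p.1 B mB) (val01 p.2))); split.
- move=> B mB; have mv : measurable_fun [set: Z * I] (fun p => (p.1, val01 p.2)).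
    apply: measurable_fun_pair => //.
    exact: (measurableT_comp measurable_val01 measurable_snd).
  exact: (measurableT_comp (fine_measurable measurableT)
            (measurableT_comp (mdens B mB) mv)).
- move=> B mB p; rewrite -!lee_fin fineK; last exact: dens_fin.
  by rewrite dens_ge0 dens_le1.
- move=> B B' mB mB' p BB'; rewrite -lee_fin.
  rewrite (fineK (dens_fin _ _ _ _)) (fineK (dens_fin _ _ _ _)).
  apply: ball_density_le => A mA.
  have mvA : measurable (val01 @^-1` A).
    by apply: measurable_set_comp mA; exact: measurable_val01.
  rewrite (nuE _ B) (nuE _ B'); apply: measure_subset.
  + exact: (measurable_pos _ _ B mvA mB).
  + exact: (measurable_pos _ _ B' mvA mB').
  + by move=> s /= [? /BB'].
- move=> B mB z A mA; have [A' mA' AA'] := measurable_I01P A mA.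
  (* The Borel set representing [A] may leave [0, 1]; cutting it down does not change the preimage
     and allows the integral to be moved to the line. *)
  have AE : A = val01 @^-1` (A' `&` `[0, 1]).
    rewrite AA'; apply/seteqP; split => [u /= ?|u [] //]; split => //=.
    by rewrite in_itv/= val01_ge0 val01_le1.
  have mz : measurable_fun [set: R] (ball_density (nu z B mB)).
    exact: (measurable_fun_pair2 z (mdens B mB)).
  have mA01 : measurable (A' `&` `[0, 1]) by exact: measurableI.
  transitivity (\int[lam]_(v in A) ball_density (nu z B mB) (val01 v))%E.
    by apply: eq_integral => v _; rewrite /= (fineK (dens_fin _ _ _ _)).
  rewrite {1}AE integral_lambda01//.
  have nule C : measurable C -> (nu z B mB C <= lebesgue_measure C)%E.
    by move=> mC; exact: nu_le.
  rewrite (integral_ball_density _ nule (nu_fin z B mB) mz _ mA01).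
  by rewrite nuE AE.
Qed.

End conditional_density.

(** * Conditional quantiles given a uniform variable *)

Section conditional_quantile.
Context {R : realType} {dZ dS} {Z : measurableType dZ} {S : measurableType dS}
  (Pi : R.-pker Z ~> S).
Local Notation I := (I01 R).
Local Notation lam := (lambda01 R).
Variable pos : Z * S -> I.
Hypotheses (mpos : measurable_fun [set: Z * S] pos)
  (pos_law : forall z A, measurable A -> Pi z [set s | A (pos (z, s))] = lam A).
Variable e : S -> R.
Hypotheses (me : measurable_fun [set: S] e) (e01 : forall s, 0 <= e s <= 1).

Let mposz z : measurable_fun [set: S] (fun s => pos (z, s)).
Proof. exact: (measurable_fun_pair2 z mpos). Qed.

Let mle (t : R) : measurable [set s | e s <= t]. Proof. exact: measurable_le_set. Qed.
Let mlt (t : R) : measurable [set s | e s < t]. Proof. exact: measurable_lt_set. Qed.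

Section with_density.
Variable dens : forall B : set S, measurable B -> Z * I -> R.
Hypotheses (mdens : forall B mB, measurable_fun [set: Z * I] (dens B mB))
  (dens01 : forall B mB p, 0 <= dens B mB p <= 1)
  (dens_le : forall B B' mB mB' p, B `<=` B' -> dens B mB p <= dens B' mB' p)
  (integral_dens : forall B mB z A, measurable A ->
    (\int[lam]_(v in A) (dens B mB (z, v))%:E)%E =
    Pi z [set s | A (pos (z, s)) /\ B s]).

Let mdensz z B mB : measurable_fun [set: I] (fun v => (dens B mB (z, v))%:E).
Proof.
by apply/measurable_EFinP; exact: (measurable_fun_pair2 z (mdens B mB)).
Qed.

Let D (q : rat) : Z * I -> R := dens _ (mle (ratr q)).

Let mD q : measurable_fun [set: Z * I] (D q).
Proof. exact: mdens. Qed.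

Let D01 q p : 0 <= D q p <= 1.
Proof. exact: dens01. Qed.

Let mQz z : measurable_fun [set: I * I] (fun p => quantile D ((z, p.1), p.2)).
Proof.
have h : measurable_fun [set: I * I] (fun p => ((z, p.1), p.2)).
  by apply: measurable_fun_pair => //; exact: measurable_fun_pair.
exact: (measurableT_comp (measurable_quantile D mD) h).
Qed.

Let mL z t :
  measurable_fun [set: I] (fun v => lam [set u | quantile D ((z, v), u) < t]).
Proof.
have mS : measurable [set p : I * I | quantile D ((z, p.1), p.2) < t].
  apply: measurable_fun_true.
  exact: (measurable_fun_ltr (mQz z) (measurable_cst t)).
have := measurable_fun_xsection (lambda01 R) mS.
by congr measurable_fun; apply/funext => v /=; rewrite xsectionE.
Qed.

(** For fixed [v] the densities need not form a distribution function, so only integrals are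
    compared. Monotonicity places the quantile mass below the density of [e < t] and above that of
    [e <= t'] for every [t' < t], through a rational in between; after integration, letting [t']
    increase to [t] closes the gap. *)
Let integral_L z A t : measurable A ->
  (\int[lam]_(v in A) lam [set u | (quantile D ((z, v), u) < t)%R])%E =
  Pi z [set s | A (pos (z, s)) /\ e s < t].
Proof.
move=> mA.
have [t0|t0] := leP t 0.
  rewrite integral0_eq.
    rewrite (_ : [set s | _] = set0) ?measure0//.
    apply/seteqP; split => // s /= [_ st].
    by have /andP[] := e01 s; rewrite leNgt (lt_le_trans st).
  move=> v _; rewrite (_ : [set u | _] = set0) ?measure0//.
  apply/seteqP; split => // u /= ut.
  by have := quantile_ge0 D ((z, v), u); rewrite leNgt (lt_le_trans ut).
have [t1|t1] := leP t 1; last first.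
  rewrite (eq_integral (cst 1%E)); last first.
    move=> v _; rewrite (_ : [set u | _] = setT); first exact: probability_setT.
    by apply/seteqP; split => // u _ /=; exact: le_lt_trans (quantile_le1 D _) t1.
  rewrite integral_cst// mul1e.
  transitivity (Pi z [set s | A (pos (z, s))]).
    exact: esym (pos_law z A mA).
  congr (Pi z _).
  apply/seteqP; split => [s /= ?|s [] //]; split => //.
  by apply: le_lt_trans t1; have /andP[] := e01 s.
apply/eqP; rewrite eq_le; apply/andP; split.
  rewrite -(integral_dens _ (mlt t) z A mA); apply: ge0_le_integral => //.
  - exact: (measurable_funS _ _ (mL z t)).
  - exact: (measurable_funS _ _ (mdensz z _ (mlt t))).
  - move=> v _; apply: lambda01_quantile_le => // q q0 qt.
    by apply: dens_le => s /= sq; exact: le_lt_trans sq qt.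
have mAs : measurable [set s | A (pos (z, s))].
  exact: (measurable_set_comp _ _ _ _ _ _ (mposz z) mA).
rewrite (_ : [set s | _] =
    [set s | e s < t] `&` [set s | A (pos (z, s))]); last first.
  by apply/seteqP; split => s /= [].
apply: (@measure_lt_le _ _ _ (mrestr (Pi z) mAs) _ me) => t' t't.
apply: (@le_trans _ _ (Pi z [set s | A (pos (z, s)) /\ e s <= t'])).
  rewrite le_eqVlt; apply/orP; left; apply/eqP; rewrite /= /mrestr; congr (Pi z _).
  by apply/seteqP; split => s /= [].
have [t'0|t'0] := ltP t' 0.
  rewrite (_ : [set s | _] = set0) ?measure0 ?integral_ge0//.
  apply/seteqP; split => // s /= [_ st].
  by have /andP[] := e01 s; rewrite leNgt (le_lt_trans st).
have [q] := rat_in_itvoo t't; rewrite in_itv/= => /andP[t'q qt].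
have q0 : 0 <= q by rewrite -(ler_rat R) rmorph0 (le_trans t'0)// ltW.
rewrite -(integral_dens _ (mle t') z A mA); apply: ge0_le_integral => //.
- by move=> v _; rewrite lee_fin; have /andP[] := dens01 _ (mle t') (z, v).
- exact: (measurable_funS _ _ (mdensz z _ (mle t'))).
- exact: (measurable_funS _ _ (mL z t)).
- move=> v _; apply: (@le_trans _ _ (D q (z, v))%:E).
    rewrite lee_fin; apply: dens_le => s /= st'.
    by rewrite (le_trans st')// ltW.
  exact: (lambda01_quantile_ge D mD D01).
Qed.

(** For fixed [A] both sides are finite measures in [C], and [integral_L] is their equality on
    half-lines. *)
Lemma quantile_joint_law z A (C : set R) : measurable A -> measurable C ->
  (lam \x lam)%E [set p | A p.1 /\ C (quantile D ((z, p.1), p.2))] =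
  Pi z [set s | A (pos (z, s)) /\ C (e s)].
Proof.
move=> mA.
have mA1 : measurable [set p : I * I | A p.1].
  exact: (measurable_set_comp _ _ _ _ fst _ measurable_fst mA).
have mAs : measurable [set s | A (pos (z, s))].
  exact: (measurable_set_comp _ _ _ _ _ _ (mposz z) mA).
move=> mC.
pose m1 : {measure set R -> \bar R} :=
  measure_function_pushforward__canonical__measure_function_Measure
    (mrestr (lam \x lam)%E mA1) (mQz z).
pose m2 : {measure set R -> \bar R} :=
  measure_function_pushforward__canonical__measure_function_Measure
    (mrestr (Pi z) mAs) me.
have m1E B : m1 B =
    (lam \x lam)%E [set p | A p.1 /\ B (quantile D ((z, p.1), p.2))].
  rewrite /m1 /= /pushforward /mrestr; congr ((lam \x lam)%E _).
  by apply/seteqP; split => p /= [].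
have m2E B : m2 B = Pi z [set s | A (pos (z, s)) /\ B (e s)].
  rewrite /m2 /= /pushforward /mrestr; congr (Pi z _).
  by apply/seteqP; split => p /= [].
have m12 t : m1 `]-oo, t[%classic = m2 `]-oo, t[%classic.
  rewrite m1E m2E.
  rewrite (product_lambda01_restr lam A
    (fun p => `]-oo, t[%classic (quantile D ((z, p.1), p.2)))).
  transitivity (\int[lam]_(v in A) lam [set u | (quantile D ((z, v), u) < t)%R])%E.
    by apply: eq_integral => v _; congr (lam _).
  by rewrite integral_L//; congr (Pi z _).
rewrite -m1E -m2E; apply: measure_eq_halflines => // t.
rewrite m12 m2E; apply: (@le_lt_trans _ _ (Pi z setT)).
  apply: measure_subset => //; apply: measurableI => //.
  exact: (measurable_set_comp _ _ _ _ _ _ me).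
by rewrite prob_kernel ltry.
Qed.

Lemma measurable_quantile_density :
  measurable_fun [set: (Z * I) * I] (quantile D).
Proof. exact: measurable_quantile. Qed.

End with_density.

Lemma conditional_quantile : exists Q : (Z * I) * I -> R,
  measurable_fun [set: (Z * I) * I] Q /\
  forall z A (C : set R), measurable A -> measurable C ->
    (lam \x lam)%E [set p | A p.1 /\ C (Q ((z, p.1), p.2))] =
    Pi z [set s | A (pos (z, s)) /\ C (e s)].
Proof.
have [dens [md d01 dle dint]] := conditional_density Pi pos mpos pos_law.
exists (quantile (fun q => dens _ (mle (ratr q)))); split.
  exact: measurable_quantile_density.
by move=> z A C mA mC; exact: (quantile_joint_law dens md d01 dle dint).
Qed.

End conditional_quantile.


(** The product measure is the composite of [k] with the kernel sending [t] to the law of [(t, u)]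
    for uniform [u], so the integral formula for composite kernels applies. *)
Lemma integral_kernel_lambda {R : realType} {d d'} {W : measurableType d}
    {T : measurableType d'} (k : R.-pker W ~> T) w (h : T * I01 R -> \bar R) :
  measurable_fun [set: T * I01 R] h -> (forall p, 0 <= h p)%E ->
  (\int[kernel_lambda k w]_p h p = \int[k w]_t \int[lambda01 R]_u h (t, u))%E.
Proof.
move=> mh h0.
have mpair : measurable_fun [set: (W * T) * I01 R] (fun p => (p.1.2, p.2)).
  apply: measurable_fun_pair => //.
  exact: (measurableT_comp measurable_snd measurable_fst).
pose kk := kernel_image (kernel_cst (W * T)%type (lambda01 R)) _ mpair.
transitivity (\int[kcomp k kk w]_p h p)%E.
  apply: eq_measure_integral => C mC _; apply: eq_integral => t _.
  by rewrite /= xsectionE.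
rewrite integral_kcomp//; apply: eq_integral => t _.
have mt : measurable_fun [set: I01 R] (fun u => (t, u)) by exact: measurable_pair1.
by rewrite [LHS](ge0_integral_pushforward mt).
Qed.

Section disintegration.
Context {R : realType} {dX dY dZ} {X : measurableType dX} {Y : measurableType dY}
  {Z : measurableType dZ} (pi : R.-pker Z ~> (X * Y)%type).

Lemma measurable_snd_fst : measurable_fun [set: Z * (X * Y)] (fun p => p.2.1).
Proof. exact: (measurableT_comp measurable_fst measurable_snd). Qed.

Local Notation mu := (kernel_image pi (fun p => p.2.1) measurable_snd_fst).
Local Notation I := (I01 R).
Local Notation lam := (lambda01 R).

Section transported.
Variables (a : Z * I -> X * I) (b : Z * (X * I) -> I).
Hypotheses (ma : measurable_fun [set: Z * I] a)
  (mb : measurable_fun [set: Z * (X * I)] b)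
  (aK : forall z u, b (z, a (z, u)) = u) (bK : forall z s, a (z, b (z, s)) = s)
  (a_law : forall z B, measurable B ->
     lam [set u | B (a (z, u))] = (mu z \x lam)%E B).
Variables (e : Y -> R) (r : R -> Y).
Hypotheses (me : measurable_fun [set: Y] e) (mr : measurable_fun [set: R] r)
  (eK : cancel e r) (e_cantor : forall y, cantor_set (e y)).

Let e01 y : 0 <= e y <= 1.
Proof. by have := cantor_set_itv _ (e_cantor y); rewrite /= in_itv. Qed.

Let Pi := kernel_lambda pi.

(** The auxiliary coordinate spreads out the atoms of the first marginal: the pair of [x] and this
    coordinate, pulled back by [b], is uniform and still determines [x]. *)
Let pos (p : Z * ((X * Y) * I)) : I := b (p.1, (p.2.1.1, p.2.2)).

Let mpos : measurable_fun [set: Z * ((X * Y) * I)] pos.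
Proof.
apply: (measurableT_comp mb); apply: measurable_fun_pair => //.
apply: measurable_fun_pair.
  exact: (measurableT_comp measurable_fst
            (measurableT_comp measurable_fst measurable_snd)).
exact: (measurableT_comp measurable_snd measurable_snd).
Qed.

Let mposz z : measurable_fun [set: (X * Y) * I] (fun s => pos (z, s)).
Proof. exact: measurable_fun_pair2. Qed.

Let pos_law z A : measurable A -> Pi z [set s | A (pos (z, s))] = lam A.
Proof.
move=> mA.
have mbA : measurable [set t | A (b (z, t))].
  exact: (measurable_set_comp _ _ _ _ _ _ (measurable_fun_pair2 z mb) mA).
rewrite -[LHS](kernel_lambda_image pi _ measurable_snd_fst z _ mbA).
rewrite -[LHS](a_law z _ mbA).
by congr (lam _); apply/seteqP; split => u /=; rewrite aK.
Qed.

Let ev (s : (X * Y) * I) : R := e s.1.2.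

Let mev : measurable_fun [set: (X * Y) * I] ev.
Proof.
exact: (measurableT_comp me (measurableT_comp measurable_snd measurable_fst)).
Qed.

Lemma transported_quantile : exists Q : (Z * I) * I -> R,
  measurable_fun [set: (Z * I) * I] Q /\
  forall z A (C : set R), measurable A -> measurable C ->
    (lam \x lam)%E [set p | A p.1 /\ C (Q ((z, p.1), p.2))] =
    (pi z \x lam)%E [set s | A (b (z, (s.1.1, s.2))) /\ C (e s.1.2)].
Proof.
have [Q [mQ QE]] := conditional_quantile Pi pos mpos pos_law ev mev
  (fun s => e01 s.1.2).
by exists Q; split => // z A C mA mC; exact: QE.
Qed.

Variable Q : (Z * I) * I -> R.
Hypotheses (mQ : measurable_fun [set: (Z * I) * I] Q)
  (Q_law : forall z A (C : set R), measurable A -> measurable C ->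
    (lam \x lam)%E [set p | A p.1 /\ C (Q ((z, p.1), p.2))] =
    (pi z \x lam)%E [set s | A (b (z, (s.1.1, s.2))) /\ C (e s.1.2)]).

Let F (p : (Z * X) * (I * I)) : Y :=
  r (Q ((p.1.1, b (p.1.1, (p.1.2, p.2.1))), p.2.2)).

Let mF : measurable_fun [set: (Z * X) * (I * I)] F.
Proof.
have m11 : measurable_fun [set: (Z * X) * (I * I)] (fun p => p.1.1).
  exact: (measurableT_comp measurable_fst measurable_fst).
have m12 : measurable_fun [set: (Z * X) * (I * I)] (fun p => p.1.2).
  exact: (measurableT_comp measurable_snd measurable_fst).
have m21 : measurable_fun [set: (Z * X) * (I * I)] (fun p => p.2.1).
  exact: (measurableT_comp measurable_fst measurable_snd).
have m22 : measurable_fun [set: (Z * X) * (I * I)] (fun p => p.2.2).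
  exact: (measurableT_comp measurable_snd measurable_snd).
apply: (measurableT_comp mr); apply: (measurableT_comp mQ).
apply: measurable_fun_pair => //; apply: measurable_fun_pair => //.
apply: (measurableT_comp mb); apply: measurable_fun_pair => //.
exact: measurable_fun_pair.
Qed.

(* Q gives the conditional law of e(y) given the uniform variable b(z, (x, u));
   averaging over u yields a conditional law of y given x alone. *)
Definition conditional_kernel :=
  kernel_image (kernel_lambda (kernel_cst (Z * X)%type lam)) F mF.

HB.instance Definition _ := ProbabilityKernel.on conditional_kernel.

(** Integrating over [x] and the averaged coordinate is integrating over the law of [a (z, v)] with
    [v] uniform. The inner [b] then cancels against [a], which leaves the joint law of [v] and the
    quantile, known from [Q_law]. *)
Lemma conditional_kernel_rectangle z A B : measurable A -> measurable B ->
  (\int[mu z]_x conditional_kernel (z, x) [set y | A x /\ B y])%E =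
  pi z [set p | A p.1 /\ B p.2].
Proof.
move=> mA mB.
have mrB : measurable [set t | B (r t)] by exact: measurable_set_comp.
pose S : set ((X * I) * I) := [set p | A p.1.1 /\ B (r (Q ((z, b (z, p.1)), p.2)))].
have mS : measurable S.
  apply: measurableI.
    apply: (measurable_set_comp _ _ _ _ (fun p : (X * I) * I => p.1.1)) => //.
    exact: (measurableT_comp measurable_fst measurable_fst).
  apply: (measurable_set_comp _ _ _ _
    (fun p : (X * I) * I => r (Q ((z, b (z, p.1)), p.2)))) => //.
  apply: (measurableT_comp mr); apply: (measurableT_comp mQ).
  apply: measurable_fun_pair => //; apply: measurable_fun_pair => //.
  exact: (measurableT_comp (measurable_fun_pair2 z mb) measurable_fst).
pose psi (p : X * I) := lam [set u | S (p, u)].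
have mpsi : measurable_fun [set: X * I] psi.
  have := measurable_fun_xsection lam mS.
  by congr measurable_fun; apply/funext => p /=; rewrite xsectionE.
have psi0 p : (0 <= psi p)%E by exact: measure_ge0.
have maz : measurable_fun [set: I] (fun v => a (z, v)).
  exact: (measurable_fun_pair2 z ma).
transitivity (\int[kernel_lambda mu z]_p psi p)%E.
  rewrite (integral_kernel_lambda mu z psi mpsi psi0); apply: eq_integral => x _.
  rewrite /conditional_kernel kernel_imageE.
  by apply: eq_integral => u _; congr (lam _); rewrite xsectionE.
transitivity (\int[lam]_v psi (a (z, v)))%E.
  rewrite (@eq_measure_integral _ _ _ _
    (measure_function_pushforward__canonical__measure_function_Measure
      lam maz)).
    by rewrite (ge0_integral_pushforward maz).
  by move=> C mC _; rewrite -[LHS](a_law z C mC).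
(* As [v] determines [x], the condition on [x] becomes a condition on [v], the form in which [Q_law]
   can be used. *)
pose A' := [set v | A (a (z, v)).1].
have mA' : measurable A'.
  apply: (measurable_set_comp _ _ _ _ (fun v => (a (z, v)).1)) => //.
  exact: (measurableT_comp measurable_fst maz).
transitivity ((lam \x lam)%E [set p | A' p.1 /\ B (r (Q ((z, p.1), p.2)))]).
  apply: eq_integral => v _; congr (lam _); rewrite xsectionE.
  by apply/seteqP; split => u; rewrite /S /= aK.
rewrite (Q_law z A' [set t | B (r t)] mA' mrB).
rewrite (_ : [set s | _] = [set p | A p.1 /\ B p.2] `*` setT).
  rewrite [LHS]product_measure1E//.
    by rewrite [X in (_ * X)%E]probability_setT mule1.
  by apply: measurableI; [exact: (measurable_set_comp _ _ _ _ fst)|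
                          exact: (measurable_set_comp _ _ _ _ snd)].
apply/seteqP; split => [[[x y] u]|[[x y] u]]; rewrite /A' /= bK eK /=.
  by [].
by move=> [].
Qed.

End transported.

Hypotheses (rX : real_retract R X) (rY : real_retract R Y).

(** Rectangles generate the product sigma-algebra and are stable under intersection, so agreement on
    them identifies [pi z] with the composite of its marginal and [k]. *)
Lemma disintegration : exists k : R.-pker (Z * X)%type ~> Y,
  forall z (h : X * Y -> \bar R), measurable_fun [set: X * Y] h ->
    (forall p, 0 <= h p)%E ->
    (\int[pi z]_p h p = \int[mu z]_x \int[k (z, x)]_y h (x, y))%E.
Proof.
have [a [b [ma mb aK bK a_law]]] := kernel_isomorphism mu rX.
have [e [r [me mr eK ec]]] := real_retract_cantor _ _ _ rY.
have [Q [mQ Q_law]] := transported_quantile a b mb aK a_law e me ec.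
pose k : R.-pker (Z * X)%type ~> Y := conditional_kernel b mb r mr Q mQ.
have kE z A B : measurable A -> measurable B ->
    (\int[mu z]_x k (z, x) [set y | A x /\ B y])%E = pi z [set p | A p.1 /\ B p.2].
  exact: (conditional_kernel_rectangle a b ma mb aK bK a_law e r mr eK Q mQ Q_law).
exists k => z h mh h0.
have mpair : measurable_fun [set: (Z * X) * Y] (fun p => (p.1.2, p.2)).
  apply: measurable_fun_pair => //.
  exact: (measurableT_comp measurable_snd measurable_fst).
(* Remembering [x] next to [y] makes the composite kernel a measure on pairs. *)
pose kk := kernel_image k _ mpair.
have kkE A B : measurable A -> measurable B ->
    kcomp mu kk z (A `*` B) = pi z (A `*` B).
  move=> mA mB; rewrite -[RHS](kE z A B mA mB); apply: eq_integral => x _.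
  by rewrite /kk kernel_imageE.
transitivity (\int[kcomp mu kk z]_p h p)%E; last first.
  rewrite integral_kcomp//; apply: eq_integral => x _.
  have mx : measurable_fun [set: Y] (fun y => (x, y)) by exact: measurable_pair1.
  by rewrite [LHS](ge0_integral_pushforward mx).
apply: eq_measure_integral => C mC _; symmetry.
apply: (measure_unique [set A `*` B | A in measurable & B in measurable]
  (fun=> setT)) => //.
- exact: measurable_prod_measurableType.
- move=> _ _ [X1 mX1 [X2 mX2 <-]] [Y1 mY1 [Y2 mY2 <-]].
  exists (X1 `&` Y1); first exact: measurableI.
  by exists (X2 `&` Y2); [exact: measurableI|rewrite setXI].
- by move=> _; exists setT => //; exists setT => //; rewrite setXTT.
- by rewrite bigcup_const.
- by move=> _ [A mA [B mB <-]]; exact: (kkE A B mA mB).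
- move=> _; rewrite /= /mkcomp /kcomp.
  rewrite (eq_integral (cst 1%E)); last by move=> x _; exact: prob_kernel.
  by rewrite integral_cst// mul1e [ltLHS]prob_kernel ltry.
Qed.

End disintegration.

(** * Couplings realised by isomorphisms, and the composite map *)

Section coupling.
Context {R : realType} {dX dY dZ} {X : measurableType dX} {Y : measurableType dY}
  {Z : measurableType dZ} (pi : R.-pker Z ~> (X * Y)%type).
Hypotheses (rX : real_retract R X) (rY : real_retract R Y).

(** The kernel isomorphism applied to the disintegration. The right-hand side is the law of
    [(x, (y, v))] with [(x, y)] drawn from [pi z] and [v] uniform and independent; keeping [x] in
    [G] records the coupling and not only the law of the image. *)
Lemma coupling_isomorphism :
  exists (a : (Z * X) * I01 R -> Y * I01 R) (b : (Z * X) * (Y * I01 R) -> I01 R),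
  [/\ measurable_fun [set: (Z * X) * I01 R] a,
      measurable_fun [set: (Z * X) * (Y * I01 R)] b,
      (forall w u, b (w, a (w, u)) = u), (forall w s, a (w, b (w, s)) = s) &
      forall z (G : set (X * (Y * I01 R))), measurable G ->
        (pushforward (pi z) fst \x lambda01 R)%E
          [set p | G (p.1, a ((z, p.1), p.2))] =
        (\int[pi z]_q lambda01 R [set v | G (q.1, (q.2, v))])%E].
Proof.
have [k kE] := disintegration pi rX rY.
have [a [b [ma mb aK bK a_law]]] := kernel_isomorphism k rY.
exists a, b; split => // z G mG.
pose G' : set ((X * Y) * I01 R) := [set p | G (p.1.1, (p.1.2, p.2))].
have mG' : measurable G'.
  apply: (measurable_set_comp _ _ _ _
    (fun p : (X * Y) * I01 R => (p.1.1, (p.1.2, p.2)))) => //.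
  apply: measurable_fun_pair.
    exact: (measurableT_comp measurable_fst measurable_fst).
  apply: measurable_fun_pair => //.
  exact: (measurableT_comp measurable_snd measurable_fst).
pose h (q : X * Y) : \bar R := lambda01 R [set v | G (q.1, (q.2, v))].
have mh : measurable_fun [set: X * Y] h.
  have := measurable_fun_xsection (lambda01 R) mG'.
  by congr measurable_fun; apply/funext => q /=; rewrite xsectionE.
rewrite (kE z h mh (fun=> measure_ge0 _ _)); apply: eq_integral => x _ /=.
have mGx : measurable [set s | G (x, s)].
  by apply: (measurable_set_comp _ _ _ _ (fun s => (x, s))) => //;
    exact: measurable_pair1.
transitivity (lambda01 R [set u | G (x, a ((z, x), u))]).
  by congr (lambda01 R _); rewrite xsectionE.
rewrite (a_law (z, x) _ mGx); apply: eq_integral => y _ /=.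
by congr (lambda01 R _); rewrite xsectionE.
Qed.

End coupling.

Theorem theorem2p3 (R : realType) (dX dY dZ : measure_display)
  (X : measurableType dX) (Y : measurableType dY) (Z : measurableType dZ)
  (sX : standard_Borel R X) (sY : standard_Borel R Y) (sZ : standard_Borel R Z)
  (uX : ~ countable [set: X]) (uY : ~ countable [set: Y])
  (uZ : ~ countable [set: Z])
  (pi : R.-pker Z ~> (X * Y)%type) :
  let mu := fun z : Z => pushforward (pi z) (@fst X Y) in
  let nu := fun z : Z => pushforward (pi z) (@snd X Y) in
  exists T : Z * X * I01 R -> Y * I01 R,
    measurable_fun [set: Z * X * I01 R] T /\
    forall z : Z,
      let Tz := fun p : X * I01 R => T (z, p.1, p.2) in
      [/\ (exists S : Y * I01 R -> X * I01 R,
             [/\ cancel Tz S, cancel S Tz,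
                 measurable_fun [set: X * I01 R] Tz &
                 measurable_fun [set: Y * I01 R] S]),
          (forall B : set (Y * I01 R), measurable B ->
             pushforward (mu z \x lambda01 R)%E Tz B = (nu z \x lambda01 R)%E B) &
          (forall C : set (X * Y), measurable C ->
             pushforward
               (pushforward (mu z \x lambda01 R)%E
                  (fun p : X * I01 R => (p, Tz p)))
               (fun q : (X * I01 R) * (Y * I01 R) => (q.1.1, q.2.1)) C
             = pi z C)].

Proof.
have rX := standard_Borel_retract R dX X sX.
have rY := standard_Borel_retract R dY Y sY.
(* Exchanging the coordinates lets the same lemma serve with [Y] as the retained coordinate. *)
have mswap : measurable_fun [set: Z * (X * Y)] (fun p => (p.2.2, p.2.1)).
  apply: measurable_fun_pair.
    exact: (measurableT_comp measurable_snd measurable_snd).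
  exact: (measurableT_comp measurable_fst measurable_snd).
pose pi' := kernel_image pi _ mswap.
have [a [b [ma mb aK bK a_law]]] := coupling_isomorphism pi rX rY.
have [a' [b' [ma' mb' aK' bK' a_law']]] := coupling_isomorphism pi' rY rX.
move=> mu nu.
(* [a] turns [(x, u)] into the triple [(x, y, v)]; regrouped as [y] with [(x, v)], it is sent by
   [b'] to a point of [0, 1]. [S] runs through the same triple backwards. *)
pose T (p : Z * X * I01 R) : Y * I01 R :=
  let s := a p in (s.1, b' ((p.1.1, s.1), (p.1.2, s.2))).
pose S z (p : Y * I01 R) : X * I01 R :=
  let s := a' ((z, p.1), p.2) in (s.1, b ((z, s.1), (p.1, s.2))).
have mT : measurable_fun [set: Z * X * I01 R] T.
  have ma1 := measurableT_comp measurable_fst ma.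
  have ma2 := measurableT_comp measurable_snd ma.
  have m11 : measurable_fun [set: Z * X * I01 R] (fun p => p.1.1).
    exact: (measurableT_comp measurable_fst measurable_fst).
  have m12 : measurable_fun [set: Z * X * I01 R] (fun p => p.1.2).
    exact: (measurableT_comp measurable_snd measurable_fst).
  apply: measurable_fun_pair => //; apply: (measurableT_comp mb').
  by apply: measurable_fun_pair; exact: measurable_fun_pair.
have mS z : measurable_fun [set: Y * I01 R] (S z).
  have mz : measurable_fun [set: Y * I01 R] (fun p => ((z, p.1), p.2)).
    by apply: measurable_fun_pair => //; exact: measurable_fun_pair.
  have maz := measurableT_comp ma' mz.
  have ma1 := measurableT_comp measurable_fst maz.
  have ma2 := measurableT_comp measurable_snd maz.
  apply: measurable_fun_pair => //; apply: (measurableT_comp mb).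
  apply: measurable_fun_pair; last exact: measurable_fun_pair.
  exact: measurable_fun_pair.
exists T; split => // z Tz.
have mTz : measurable_fun [set: X * I01 R] Tz.
  apply: (measurableT_comp mT); apply: measurable_fun_pair => //.
  exact: measurable_fun_pair.
split.
- exists (S z); split => //.
  + by move=> [x u]; rewrite /S /Tz /T /= bK' /= -surjective_pairing aK.
  + by move=> [y t]; rewrite /S /Tz /T /= bK /= -surjective_pairing aK'.
- move=> B mB.
  pose G : set (X * (Y * I01 R)) := [set p | B (p.2.1, b' ((z, p.2.1), (p.1, p.2.2)))].
  pose G' : set (Y * (X * I01 R)) := [set p | B (p.1, b' ((z, p.1), p.2))].
  have mG' : measurable G'.
    apply: (measurable_set_comp _ _ _ _
      (fun p : Y * (X * I01 R) => (p.1, b' ((z, p.1), p.2)))) => //.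
    apply: measurable_fun_pair => //; apply: (measurableT_comp mb').
    by apply: measurable_fun_pair => //; exact: measurable_fun_pair.
  have mG : measurable G.
    apply: (measurable_set_comp _ _ _ _
      (fun p : X * (Y * I01 R) => (p.2.1, (p.1, p.2.2))) _ _ mG').
    apply: measurable_fun_pair.
      exact: (measurableT_comp measurable_fst measurable_snd).
    apply: measurable_fun_pair => //.
    exact: (measurableT_comp measurable_snd measurable_snd).
  transitivity (\int[pi z]_q lambda01 R [set v | G (q.1, (q.2, v))])%E.
    exact: (a_law z G mG).
  (* Since [b'] undoes [a'], the set [B] is a condition on the triple produced by [a'], so the law
     of the second coupling computes its measure under the second marginal times [lambda01]. *)
  have -> : B = [set p | G' (p.1, a' ((z, p.1), p.2))].
    by apply/seteqP; split => -[y t]; rewrite /G' /= aK'.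
  rewrite [RHS](a_law' z G' mG').
  have mswz : measurable_fun [set: X * Y] (fun q => (q.2, q.1)).
    exact: measurable_fun_pair.
  rewrite [RHS](ge0_integral_pushforward mswz)//.
  pose H : set ((Y * X) * I01 R) := [set p | G' (p.1.1, (p.1.2, p.2))].
  have mH : measurable H.
    apply: (measurable_set_comp _ _ _ _
      (fun p : (Y * X) * I01 R => (p.1.1, (p.1.2, p.2))) _ _ mG').
    apply: measurable_fun_pair.
      exact: (measurableT_comp measurable_fst measurable_fst).
    apply: measurable_fun_pair => //.
    exact: (measurableT_comp measurable_snd measurable_fst).
  have := measurable_fun_xsection (lambda01 R) mH.
  by congr measurable_fun; apply/funext => q /=; rewrite xsectionE.
- move=> C mC.
  (* [T] keeps the [Y]-coordinate produced by [a], so only the first coupling matters, and the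
     uniform coordinate integrates to 1. *)
  pose G : set (X * (Y * I01 R)) := [set p | C (p.1, p.2.1)].
  have mG : measurable G.
    apply: (measurable_set_comp _ _ _ _
      (fun p : X * (Y * I01 R) => (p.1, p.2.1)) _ _ mC).
    apply: measurable_fun_pair => //.
    exact: (measurableT_comp measurable_fst measurable_snd).
  transitivity (\int[pi z]_q lambda01 R [set v | G (q.1, (q.2, v))])%E.
    exact: (a_law z G mG).
  transitivity (\int[pi z]_q (\1_C q)%:E)%E; last by rewrite integral_indic// setIT.
  apply: eq_integral => -[x y] _; rewrite indicE /G /=.
  have [xyC|xyC] := boolP ((x, y) \in C).
    rewrite (_ : [set _ | _] = setT); first exact: probability_setT.
    by apply/seteqP; split => // v _ /=; exact: set_mem.
  rewrite (_ : [set _ | _] = set0) ?measure0//.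
  by apply/seteqP; split => // v /= /mem_set; rewrite (negbTE xyC).
Qed.
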